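(* Let $\alpha\in[1,2]$ and $a>0$. (1) (Tensorisation) Let $\mu_1$ and $\mu_2$ be probability measures on $\mathbb{R}^{n_1}$ and $\mathbb{R}^{n_2}$ respectively. If $\mu_1$ satisfies $LSI_{a,\alpha}(C_1)$ and $\mu_2$ satisfies $LSI_{a,\alpha}(C_2)$, then the product probability measure $\mu_1\otimes\mu_2$ on $\mathbb{R}^{n_1+n_2}$ satisfies $LSI_{a,\alpha}(D)$ with $D=\max\{C_1,C_2\}$. (2) (Perturbation) Let $\mu$ be a probability measure on $\mathbb{R}^n$ satisfying $LSI_{a,\alpha}(C)$. Let $h$ be a bounded function on $\mathbb{R}^n$ and let $d\tilde\mu=\frac{e^{h}}{Z}d\mu$ with $Z=\int e^h d\mu$. Then $\tilde\mu$ satisfies $LSI_{a,\alpha}(D)$ with $D=Ce^{\mathrm{osc}(h)}$, where $\mathrm{osc}(h)=\sup(h)-\inf(h)$. (3) (Poincaré inequality) Let $\mu$ be a probability measure on $\mathbb{R}^n$. If $\mu$ satisfies $LSI_{a,\alpha}(C)$, then $\mu$ satisfies a Poincaré inequality with constant $C/2$, i.e. for every smooth function $f$, $$\mathbf{Var}_\mu(f)\le \frac{C}{2}\int|\nabla f|^2d\mu .$$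
   Context: For $\alpha\in[1,2]$ let $\beta\in[2,\infty]$ satisfy $1/\alpha+1/\beta=1$ ($\beta=\infty$ if $\alpha=1$), and let $a>0$. If $\alpha\in(1,2]$, $H_{a,\alpha}:\mathbb{R}\to\mathbb{R}$ is $H_{a,\alpha}(x)=\frac{x^2}{2}$ if $|x|\le a$ and $H_{a,\alpha}(x)=a^{2-\beta}\frac{|x|^\beta}{\beta}+a^2\frac{\beta-2}{2\beta}$ if $|x|\ge a$. If $\alpha=1$, $H_{a,1}(x)=\frac{x^2}{2}$ if $|x|\le a$ and $H_{a,1}(x)=+\infty$ if $|x|>a$. For $x=(x_1,\dots,x_n)\in\mathbb{R}^n$, $H_{a,\alpha}(x)=\sum_{i=1}^nH_{a,\alpha}(x_i)$. A probability measure $\mu$ on $\mathbb{R}^n$ satisfies $LSI_{a,\alpha}(C)$ (logarithmic Sobolev inequality of function $H_{a,\alpha}$ with constant $C$) if for every $C^\infty$ and $L^2$ function $f$ on $\mathbb{R}^n$, $$\mathbf{Ent}_\mu(f^2)\le C\int H_{a,\alpha}\Big(\frac{\nabla f}{f}\Big)f^2d\mu,$$ where $\mathbf{Ent}_\mu(f^2)=\int f^2\log\frac{f^2}{\int f^2d\mu}d\mu$ and $H_{a,\alpha}(\frac{\nabla f}{f})=\sum_{i=1}^nH_{a,\alpha}\big(\frac{\partial f}{\partial x_i}\frac1f\big)$, with the convention $0/0=\infty$. Also $\mathbf{Var}_\mu(f)=\int f^2d\mu-(\int f d\mu)^2$. *)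

(* Defs.v *)
From HB Require Import structures.
From mathcomp Require Import all_boot all_order all_algebra.
From mathcomp Require Import all_classical all_reals all_analysis.
From mathcomp Require Import measurable_realfun.

Set Implicit Arguments.
Unset Strict Implicit.
Unset Printing Implicit Defensive.

Import Order.TTheory GRing.Theory Num.Theory.
Import numFieldNormedType.Exports.

Local Open Scope classical_set_scope.
Local Open Scope ring_scope.

(* R^n as row vectors with the Borel sigma-algebra. *)
Notation Rn R n := (g_sigma_algebraType (@open 'rV[R]_n)).

Section functional.
Context {R : realType}.
Implicit Types (n : nat) (a alpha C : R).

Definition partial n (i : 'I_n) (f : 'rV[R]_n -> R) : 'rV[R]_n -> R :=
  'D_(delta_mx 0 i) f.

Definition iter_partial n (s : seq 'I_n) (f : 'rV[R]_n -> R) :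
    'rV[R]_n -> R :=
  foldr (@partial n) f s.

(* C^oo: the iterated partial derivatives of all orders exist and are
   continuous. *)
Definition smooth n (f : 'rV[R]_n -> R) : Prop :=
  forall s : seq 'I_n, continuous (iter_partial s f) /\
    forall (i : 'I_n) (x : 'rV[R]_n),
      derivable (iter_partial s f) x (delta_mx 0 i).

(* The solution beta of 1/alpha + 1/beta = 1, for alpha != 1. *)
Definition conjugate_exponent alpha : R := (1 - alpha^-1)^-1.

Definition H a alpha (x : R) : \bar R :=
  if `|x| <= a then (x ^+ 2 / 2)%:E
  else if alpha == 1 then +oo%E
  else let beta := conjugate_exponent alpha in
    (a `^ (2 - beta) * (`|x| `^ beta / beta)
      + a ^+ 2 * ((beta - 2) / (2 * beta)))%:E.

(* H extended by H(+oo) = H(-oo) = +oo. *)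
Definition H_ext a alpha (x : \bar R) : \bar R :=
  if x is r%:E then H a alpha r else +oo%E.

(* The quotient u / v, with 0 / 0 = +oo. For u != 0 the sign of u / 0 is
   irrelevant below, since H_ext is even. *)
Definition quot (u v : R) : \bar R :=
  if v == 0 then +oo%E else (u / v)%:E.

Definition H_grad n a alpha (f : 'rV[R]_n -> R) (x : 'rV[R]_n) : \bar R :=
  (\sum_(i < n) H_ext a alpha (quot (partial i f x) (f x)))%E.

Definition L2 n (mu : probability (Rn R n) R) (f : 'rV[R]_n -> R) : Prop :=
  mu.-integrable setT (fun x => (f x ^+ 2)%:E).

Definition Ent n (mu : probability (Rn R n) R) (g : 'rV[R]_n -> R) : \bar R :=
  (\int[mu]_x (g x * ln (g x / Rintegral mu setT g))%:E)%E.

(* Rintegral is 0 when the integral of f is infinite or undefined, so that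
   Var mu f = +oo for every (measurable) f that is not in L^2(mu). *)
Definition Var n (mu : probability (Rn R n) R) (f : 'rV[R]_n -> R) : \bar R :=
  ((\int[mu]_x (f x ^+ 2)%:E) - (Rintegral mu setT f ^+ 2)%:E)%E.

(* In \bar R, +oo * 0 = 0: the integrand on the right-hand side vanishes where
   f does (for n > 0, H_grad is +oo there). *)
Definition LSI n a alpha (mu : probability (Rn R n) R) C : Prop :=
  forall f : 'rV[R]_n -> R, smooth f -> L2 mu f ->
    (Ent mu (fun x => f x ^+ 2)%R
       <= C%:E * \int[mu]_x (H_grad a alpha f x * (f x ^+ 2)%:E))%E.

Definition osc T (h : T -> R) : R := sup (range h) - inf (range h).

End functional.

Section tilt.
Context {R : realType} {n : nat}.
Variables (mu : probability (Rn R n) R) (h : Rn R n -> R).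

(* The measure (e^h / Z) dmu, with Z the integral of e^h. *)
Definition tilt (mh : measurable_fun setT h) (bh : bounded_fun h) :
    set (Rn R n) -> \bar R :=
  fun A => (\int[mu]_(x in A)
    (expR (h x) / Rintegral mu setT (fun y => expR (h y)))%:E)%E.

Hypotheses (mh : measurable_fun setT h) (bh : bounded_fun h).

Let Z := Rintegral mu setT (fun y => expR (h y)).

Let meh : measurable_fun setT (fun y => expR (h y)).
Proof. exact: measurableT_comp. Qed.

Let intZ : (\int[mu]_x (expR (h x))%:E)%E = Z%:E /\ 0 < Z.
Proof.
have [M [_ hM]] := bh.
have {}hM x : `|h x| <= M + 1 by apply: (hM (M + 1)) => //; rewrite ltrDl.
have mE : measurable_fun setT (EFin \o (fun x => expR (h x))).
  exact/measurable_EFinP.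
have up : (\int[mu]_x (expR (h x))%:E <= (expR (M + 1))%:E)%E.
  rewrite -[leRHS]mule1 -(probability_setT mu) -integral_cst//.
  apply: ge0_le_integral => //= x _; rewrite lee_fin ler_expR.
  exact: le_trans (ler_norm _) (hM x).
have lo : ((expR (- (M + 1)))%:E <= \int[mu]_x (expR (h x))%:E)%E.
  rewrite -[leLHS]mule1 -(probability_setT mu) -integral_cst//.
  apply: ge0_le_integral => //= x _; rewrite lee_fin ler_expR.
  by have := hM x; rewrite ler_norml => /andP[].
have ZE : (\int[mu]_x (expR (h x))%:E)%E = Z%:E.
  rewrite /Z /Rintegral fineK// ge0_fin_numE ?(le_lt_trans up) ?ltry//.
  by apply: integral_ge0 => x _; rewrite lee_fin expR_ge0.
split=> //; rewrite -lte_fin -ZE.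
by apply: lt_le_trans lo; rewrite lte_fin expR_gt0.
Qed.

Let dens_ge0 x : (0 <= (expR (h x) / Z)%:E)%E.
Proof. by rewrite lee_fin divr_ge0 ?expR_ge0// ltW//; case: intZ. Qed.

Let mdens : measurable_fun setT (EFin \o (fun x => expR (h x) / Z)).
Proof. by apply/measurable_EFinP; apply: measurable_funM. Qed.

Let tilt0 : tilt mh bh set0 = 0%E.
Proof. exact: integral_set0. Qed.

Let tilt_ge0 A : (0 <= tilt mh bh A)%E.
Proof. by apply: integral_ge0 => x _; exact: dens_ge0. Qed.

Let tilt_sigma_additive : semi_sigma_additive (tilt mh bh).
Proof. exact: semi_sigma_additive_nng_induced. Qed.

HB.instance Definition _ := isMeasure.Build _ _ _ (tilt mh bh)
  tilt0 tilt_ge0 tilt_sigma_additive.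

Let tilt_setT : tilt mh bh setT = 1%E.
Proof.
have [ZE Z0] := intZ; rewrite /tilt -/Z.
under eq_integral do rewrite mulrC EFinM.
have Zi0 : (0 <= (Z^-1)%:E)%E by rewrite lee_fin invr_ge0 ltW.
have mE : measurable_fun setT (EFin \o (fun x => expR (h x))).
  exact/measurable_EFinP.
by rewrite ge0_integralZl// ZE -EFinM mulVf// gt_eqF.
Qed.

HB.instance Definition _ :=
  Measure_isProbability.Build _ _ _ (tilt mh bh) tilt_setT.

End tilt.

Section product.
Context {R : realType} {n1 n2 : nat}.

Definition concat (x : Rn R n1 * Rn R n2) : Rn R (n1 + n2) :=
  row_mx (x.1 : 'rV[R]_n1) (x.2 : 'rV[R]_n2).

Let ratv n (q : 'rV[rat]_n) : 'rV[R]_n := map_mx ratr q.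

Let open_rat_balls n (U : set 'rV[R]_n) : open U ->
  U = \bigcup_(p : 'rV[rat]_n * rat)
    [set x | ball (ratv p.1) (ratr p.2) x /\
             ball (ratv p.1) (ratr p.2) `<=` U].
Proof.
move=> oU; apply/seteqP; split=> [x Ux|x [p _ [px]]]; last exact.
have : nbhs x U by exact: open_nbhs_nbhs.
rewrite -nbhs_ballE => -[_/posnumP[e] xeU].
have /rat_in_itvoo[r] : (0 : R) < e%:num / 2 by [].
rewrite in_itv/= => /andP[r0 re].
have /(_ _)/cid-/all_sig[q qx] (i : 'I_n) :
    exists q : rat, `|x 0 i - ratr q| < ratr r.
  have /rat_in_itvoo[q] : x 0 i - ratr r < x 0 i + ratr r.
    by rewrite ltrBlDr -addrA ltrDl addr_gt0.
  rewrite in_itv/= => qi; exists q.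
  by rewrite distrC ltr_distl.
have bx : ball (ratv (\row_i q i)) (ratr r) x.
  by split=> // i j; rewrite !mxE ord1; apply: ball_sym; exact: qx.
exists (\row_i q i, r) => //=; split=> // y ry; apply: xeU.
rewrite /= [e%:num]splitr.
apply: ball_triangle (le_ball (ltW re) ry).
by apply: le_ball (ltW re) _ _; exact: ball_sym.
Qed.

Lemma measurable_concat : measurable_fun setT concat.
Proof.
apply: (@measurability _ _ _ (Rn R (n1 + n2)) setT concat
  (@open 'rV[R]_(n1 + n2))) => //.
move=> _ [U oU <-]; rewrite setTI (open_rat_balls oU) preimage_bigcup.
apply: countable_bigcupT_measurable => // p.
have [pU|pU] := pselect (ball (ratv p.1) (ratr p.2) `<=` U); last first.
  by rewrite (_ : _ @^-1` _ = set0)// -subset0 => x /= [].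
rewrite (_ : _ @^-1` _ =
  (ball (ratv (lsubmx p.1)) (ratr p.2) : set (Rn R n1)) `*`
  (ball (ratv (rsubmx p.1)) (ratr p.2) : set (Rn R n2))).
  apply: measurableX; apply: sub_sigma_algebra; exact: ball_open.
apply/seteqP; split=> -[x y]/=.
- move=> [[p0 xy] _]; split; split=> // i j.
  + by have := xy i (lshift n2 j); rewrite /concat row_mxEl !mxE.
  + by have := xy i (rshift n1 j); rewrite /concat row_mxEr !mxE.
- move=> [[p0 px] [_ py]]; split=> //; split=> // i j.
  rewrite /concat/=; case: (split_ordP j) => k ->.
  + by have := px i k; rewrite row_mxEl !mxE.
  + by have := py i k; rewrite row_mxEr !mxE.
Qed.

HB.instance Definition _ :=
  isMeasurableFun.Build _ _ _ _ concat measurable_concat.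

(* The product measure on R^n1 x R^n2, transported to R^(n1 + n2). *)
Definition prod_prob (mu1 : probability (Rn R n1) R)
    (mu2 : probability (Rn R n2) R) : probability (Rn R (n1 + n2)) R :=
  distribution (mu1 \x mu2)%E concat.

End product.

(* Main.v *)
(** With [rel_ent u v = u ln (u / v) - u + v >= 0], the entropy of [g] is the
    integral of [rel_ent g m], [m] being the mean of [g], and this mean minimises
    [v |-> \int rel_ent g v].

    - Perturbation follows by comparing [rel_ent (f^2) m] under both measures,
      [m] being the mean for the original one.
    - Tensorisation: if [F] and [G] are the two marginal means of [g], then
      pointwise [rel_ent g m + F + G <= rel_ent g G + rel_ent g F + m + F G / m],
      where the corrections integrate to the same finite value [2 m]; hence the
      entropy is subadditive, and LSI is applied to almost every slice.
    - Poincare: for [g] bounded with bounded gradient, [f = 1 + e g] with [e]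
      small has [|grad f / f| <= a], where [H] is quadratic, and
      [Var f <= Ent (f^2)].  A general smooth [f] is the pointwise limit of
      [chi_k * k sin (f / k)], [chi_k] a compactly supported cutoff; Fatou's lemma
      for [2 Var f = \int\int (f x - f y)^2] passes to the limit, also when [f]
      is not square integrable. *)

Require Import Defs.
From HB Require Import structures.
From mathcomp Require Import all_boot all_order all_algebra.
From mathcomp Require Import all_classical all_reals all_analysis.
From mathcomp Require Import measurable_realfun.
From mathcomp Require Import ring lra.

Set Implicit Arguments.
Unset Strict Implicit.
Unset Printing Implicit Defensive.

Import Order.TTheory GRing.Theory Num.Theory.
Import numFieldNormedType.Exports.

Local Open Scope classical_set_scope.
Local Open Scope ring_scope.

(** * Smooth functions on R^n *)

Lemma is_derive_line (R : realType) (V : normedModType R) (f : V -> R)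
    (x v : V) (a : R) :
  is_derive x v f a <-> is_derive (0 : R) 1 (fun t : R => f (t *: v + x)) a.
Proof.
have dE : 'D_v f x = 'D_1 (fun t : R => f (t *: v + x)) 0.
  rewrite /derive; set g1 := fun h => h^-1 *: _; set g2 := fun h => h^-1 *: _.
  suff -> : g1 = g2 by [].
  apply/funext => t; rewrite /g1 /g2 /=.
  by rewrite addr0 scale0r add0r [_%:A]mulr1.
split=> -[df <-]; (split; last by rewrite dE).
  exact: (derivable1P f x v).1.
exact: (derivable1P f x v).2.
Qed.

Lemma is_derive_comp (R : realType) (V : normedModType R) (phi : R -> R)
    (f : V -> R) (x v : V) (a b : R) :
  is_derive (f x) 1 phi a -> is_derive x v f b ->
  is_derive x v (phi \o f) (a * b).
Proof.
move=> dphi /is_derive_line df; apply/is_derive_line.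
by apply: is_derive1_comp => //=; rewrite scale0r add0r.
Qed.

Section smooth.
Context {R : realType} {n : nat}.
Implicit Types (f g : 'rV[R]_n -> R) (i j : 'I_n).

Lemma smooth_stable (S : ('rV[R]_n -> R) -> Prop) :
  (forall f, S f -> continuous f) ->
  (forall f i x, S f -> derivable f x (delta_mx 0 i)) ->
  (forall f i, S f -> S (partial i f)) ->
  forall f, S f -> smooth f.
Proof.
move=> Sc Sd Sp f Sf s.
have Ss : S (iter_partial s f) by elim: s => //= i s; exact: Sp.
by split=> [|i x]; [exact: Sc|exact: Sd].
Qed.

Lemma smooth_continuous f : smooth f -> continuous f.
Proof. by move=> /(_ [::])[]. Qed.

Lemma smooth_is_derive f i x :
  smooth f -> is_derive x (delta_mx 0 i) f (partial i f x).
Proof. by move=> /(_ [::])[_ /(_ i x)] /=; exact: derivableP. Qed.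

Lemma smooth_partial f i : smooth f -> smooth (partial i f).
Proof.
move=> sf s; have -> : iter_partial s (partial i f) = iter_partial (rcons s i)
  f.
  by rewrite /iter_partial foldr_rcons.
exact: sf.
Qed.

Definition derivatives (D : nat -> R -> R) : Prop :=
  forall k (t : R), is_derive t 1 (D k) (D k.+1 t).

Lemma derivatives_continuous D k : derivatives D -> continuous (D k).
Proof.
move=> dD t; apply: differentiable_continuous; apply/derivable1_diffP.
by case: (dD k t).
Qed.

Let shift D k : derivatives D -> derivatives (fun l => D (k + l)%N).
Proof. by move=> dD l t; rewrite addnS. Qed.

(* A class of functions closed under partial derivatives, by the Leibniz and
   chain rules, hence consisting of smooth functions. *)
Inductive smooth_expr : ('rV[R]_n -> R) -> Prop :=
| Smooth_base f of smooth f : smooth_expr f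
| Smooth_comp D f of derivatives D & smooth f : smooth_expr (D 0 \o f)
| Smooth_add f g of smooth_expr f & smooth_expr g : smooth_expr (f \+ g)
| Smooth_mul f g of smooth_expr f & smooth_expr g : smooth_expr (f \* g).

Let smooth_expr_is_derive f i : smooth_expr f ->
  exists2 g, smooth_expr g & forall x, is_derive x (delta_mx 0 i) f (g x).
Proof.
elim=> [{}f sf|D {}f dD sf|{}f g sf [f' sf' df] sg [g' sg' dg]
       |{}f g sf [f' sf' df] sg [g' sg' dg]].
- exists (partial i f); first exact/Smooth_base/smooth_partial.
  by move=> x; exact: smooth_is_derive.
- exists ((D 1 \o f) \* partial i f).
    apply: Smooth_mul; first exact: (Smooth_comp (shift 1 dD) sf).
    exact/Smooth_base/smooth_partial.
  by move=> x; apply: is_derive_comp; [exact: dD|exact: smooth_is_derive].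
- exists (f' \+ g'); first exact: Smooth_add.
  by move=> x; exact: is_deriveD.
- exists ((f \* g') \+ (g \* f')).
    by apply: Smooth_add; exact: Smooth_mul.
  by move=> x; exact: is_deriveM.
Qed.

Let smooth_exprP f : smooth_expr f -> smooth f.
Proof.
apply: smooth_stable => {}f.
- elim=> [{}f|D {}f dD sf|{}f g _ cf _ cg|{}f g _ cf _ cg].
  + exact: smooth_continuous.
  + move=> x; apply: continuous_comp; first exact: smooth_continuous.
    exact: derivatives_continuous.
  + by move=> x; exact: (cvgD (cf x) (cg x)).
  + by move=> x; exact: (cvgM (cf x) (cg x)).
- by move=> i x /(smooth_expr_is_derive i)[g _ /(_ x)[]].
- move=> i /(smooth_expr_is_derive i)[g sg dg].
  suff -> : partial i f = g by [].
  by apply/funext => x; rewrite /partial; case: (dg x).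
Qed.

Lemma smooth_comp D f : derivatives D -> smooth f -> smooth (D 0 \o f).
Proof. by move=> dD sf; exact/smooth_exprP/Smooth_comp. Qed.

Lemma smoothD f g : smooth f -> smooth g -> smooth (f \+ g).
Proof. by move=> sf sg; apply/smooth_exprP/Smooth_add; exact: Smooth_base. Qed.

Lemma smoothM f g : smooth f -> smooth g -> smooth (f \* g).
Proof. by move=> sf sg; apply/smooth_exprP/Smooth_mul; exact: Smooth_base. Qed.

Lemma smooth_cst (c : R) : smooth (cst c : 'rV[R]_n -> R).
Proof.
apply: (@smooth_stable (fun f => exists c, f = cst c)); last by exists c.
- by move=> _ [b ->]; exact: cst_continuous.
- by move=> _ i x [b ->]; exact: derivable_cst.
- move=> _ i [b ->]; exists 0; apply/funext => x.
  by rewrite /partial derive_cst.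
Qed.

Lemma is_derive_coord i j (x : 'rV[R]_n) :
  is_derive x (delta_mx 0 i) (fun y : 'rV[R]_n => y 0 j) (i == j)%:R.
Proof.
apply/is_derive_line.
have -> : (fun t : R => (t *: delta_mx 0 i + x) 0 j) =
    (fun t : R => (i == j)%:R *: t + x 0 j).
  by apply/funext => t; rewrite !mxE eqxx/= eq_sym mulrC.
have h : is_derive (0:R) 1 (fun t : R => (i == j)%:R *: t + x 0 j)
   ((i == j)%:R *: 1 + 0) by apply: is_deriveD.
by apply: is_derive_eq; rewrite addr0 [LHS]mulr1.
Qed.

Lemma smooth_coord j : smooth (fun x : 'rV[R]_n => x 0 j).
Proof.
apply: (@smooth_stable (fun f => f = (fun x => x 0 j) \/ smooth f));
  last by left.
- move=> f [->|]; last exact: smooth_continuous.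
  exact: coord_continuous.
- move=> f i x [->|sf]; last by case: (smooth_is_derive i x sf).
  by case: (is_derive_coord i j x).
- move=> f i [->|]; last by right; exact: smooth_partial.
  right; rewrite (_ : partial _ _ = cst (i == j)%:R); first exact: smooth_cst.
  by apply/funext => x; rewrite /partial; case: (is_derive_coord i j x).
Qed.

Lemma smooth_sum (I : Type) (r : seq I) (F : I -> 'rV[R]_n -> R) :
  (forall k, smooth (F k)) -> smooth (fun x => \sum_(k <- r) F k x).
Proof.
move=> sF; elim: r => [|k r ih].
  rewrite (_ : (fun x => _) = cst 0); first exact: smooth_cst.
  by apply/funext => x; rewrite big_nil.
by under eq_fun do rewrite big_cons; exact: smoothD.
Qed.

Lemma partial_comp D f i x : derivatives D -> smooth f ->
  partial i (D 0 \o f) x = D 1 (f x) * partial i f x.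
Proof.
move=> dD sf.
by have [_ <-] := is_derive_comp (dD 0 (f x)) (smooth_is_derive i x sf).
Qed.

Lemma partialD f g i x : smooth f -> smooth g ->
  partial i (f \+ g) x = partial i f x + partial i g x.
Proof.
move=> /(smooth_is_derive i x) df /(smooth_is_derive i x) dg.
by have [_ <-] := is_deriveD df dg.
Qed.

Lemma partialM f g i x : smooth f -> smooth g ->
  partial i (f \* g) x = f x * partial i g x + g x * partial i f x.
Proof.
move=> /(smooth_is_derive i x) df /(smooth_is_derive i x) dg.
by have [_ <-] := is_deriveM df dg.
Qed.

Lemma partial_cst (c : R) i x : partial i (cst c) x = 0.
Proof. exact: derive_cst. Qed.

Lemma partial_coord i j x : partial i (fun y : 'rV[R]_n =>
  y 0 j) x = (i == j)%:R.
Proof. by rewrite /partial; case: (is_derive_coord i j x). Qed.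

Lemma partial_sum (I : Type) (r : seq I) (F : I -> 'rV[R]_n -> R) i x :
  (forall k, smooth (F k)) ->
  partial i (fun y => \sum_(k <- r) F k y) x = \sum_(k <- r) partial i (F k) x.
Proof.
move=> sF; elim: r => [|k r ih].
  by under eq_fun do rewrite big_nil; rewrite big_nil partial_cst.
under eq_fun do rewrite big_cons.
by rewrite big_cons -ih -partialD//; exact: smooth_sum.
Qed.

End smooth.

Section sine.
Context {R : realType}.

Definition sin_derivative (k : nat) (t : R) := sin (t + pi / 2 *+ k).

Lemma sin_derivativeS k t : sin_derivative k.+1 t = cos (t + pi / 2 *+ k).
Proof. by rewrite /sin_derivative mulrSr addrA sinDpihalf. Qed.

Lemma derivatives_sin : derivatives sin_derivative.
Proof.
move=> k t; rewrite sin_derivativeS.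
have h : is_derive t 1 (fun t =>
  t + pi / 2 *+ k : R) (1 + 0) by apply: is_deriveD.
have := @is_derive1_comp _ sin (fun t =>
  t + pi / 2 *+ k) t _ _ (is_derive_sin _) h.
by rewrite addr0 mulr1.
Qed.

Lemma norm_sin_derivative k t : `|sin_derivative k t| <= 1.
Proof. by rewrite ler_norml sin_geN1 sin_le1. Qed.

End sine.

(** * Entropy *)

Lemma measurable_inv (R : realType) : measurable_fun setT (fun x : R => x^-1).
Proof.
rewrite (_ : (fun x => _) = (fun x : R => x * (x ^+ 2) `^ (-1))).
  apply: measurable_funM => //.
  exact: (measurableT_comp (@measurable_powR R (-1)) (exprn_measurable 2%N)).
apply/funext => x; rewrite powR_inv1 ?sqr_ge0//.
have [->|x0] := eqVneq x 0; first by rewrite invr0 mul0r.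
by rewrite expr2 invfM mulrA mulfV// mul1r.
Qed.

Lemma measurable_continuous (R : realType) n (f : 'rV[R]_n -> R) :
  continuous f -> measurable_fun [set: Rn R n] f.
Proof.
move=> /continuousP cf; apply: (measurability _ (RGenOpens.measurableE R)).
move=> _ [_ [a [b ->] <-]]; rewrite setTI.
by apply: sub_sigma_algebra; exact/cf/interval_open.
Qed.

Section relative_entropy.
Context {R : realType}.
Implicit Types u v : R.

Lemma le_mul_ln u v : 0 <= u -> 0 < v -> u - v <= u * ln (u / v).
Proof.
move=> u0 v0; move: u0; rewrite le_eqVlt => /predU1P[<-|u0].
  by rewrite sub0r mul0r oppr_le0 ltW.
rewrite -[u / v]invf_div lnV ?posrE ?divr_gt0// mulrN.
have uv0 : 0 < v / u by rewrite divr_gt0.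
have := @le_ln1Dx R (v / u - 1); rewrite ltrDr addrC subrK => /(_ uv0) h.
rewrite lerNr (le_trans (ler_wpM2l (ltW u0) h))// mulrBr mulr1.
by rewrite mulrC divfK ?gt_eqF// opprB.
Qed.

(* The density of entropy relative to the reference value [v], corrected by an
   affine term so as to be nonnegative; the summand is set to 0 for [v = 0],
   where [u / v = 0]. *)
Definition rel_ent u v : R := u * ln (u / v) + (if v == 0 then 0 else v - u).

Lemma rel_entE u v : v != 0 -> rel_ent u v = u * ln (u / v) + (v - u).
Proof. by rewrite /rel_ent => /negbTE ->. Qed.

Lemma rel_ent0 u : rel_ent u 0 = 0.
Proof. by rewrite /rel_ent eqxx addr0 invr0 mulr0 ln0// mulr0. Qed.

Lemma rel_ent0l v : rel_ent 0 v = v.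
Proof.
have [->|v0] := eqVneq v 0; first exact: rel_ent0.
by rewrite rel_entE// mul0r subr0 add0r.
Qed.

Lemma rel_ent_ge0 u v : 0 <= u -> 0 <= v -> 0 <= rel_ent u v.
Proof.
move=> u0; rewrite le_eqVlt => /predU1P[<-|v0]; first by rewrite rel_ent0.
by rewrite rel_entE ?gt_eqF// -opprB subr_ge0 le_mul_ln.
Qed.

Lemma rel_ent_change u v w : 0 <= u -> 0 < v -> 0 < w ->
  rel_ent u v + (u * ln (v / w) + w - v) = rel_ent u w.
Proof.
move=> u0 v0 w0; rewrite !rel_entE ?gt_eqF//.
move: u0; rewrite le_eqVlt => /predU1P[<-|u0]; first by rewrite !mul0r; ring.
rewrite !ln_div ?posrE//; ring.
Qed.

(* This is [s - 1 <= s ln s] for [s = g m / (F G)]. *)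
Lemma rel_ent_subadditive g F G m : 0 <= g -> 0 <= F -> 0 <= G -> 0 < m ->
    (F = 0 -> g = 0) -> (G = 0 -> g = 0) ->
  rel_ent g m + F + G <= rel_ent g G + rel_ent g F + (m + F * G / m).
Proof.
move=> g0 F0 G0 m0 Fg Gg.
have [g00|gN0] := eqVneq g 0.
  rewrite g00 !rel_ent0l -addrA addrC (addrC G) lerD2l lerDl.
  by rewrite divr_ge0 ?mulr_ge0// ltW.
have gp : 0 < g by rewrite lt_def gN0.
have Fp : 0 < F by rewrite lt_def F0 andbT; apply: contra_neq gN0.
have Gp : 0 < G by rewrite lt_def G0 andbT; apply: contra_neq gN0.
rewrite !rel_entE ?gt_eqF//.
have := @le_mul_ln g (F * G / m) g0 (divr_gt0 (mulr_gt0 Fp Gp) m0).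
rewrite !ln_div ?posrE ?divr_gt0 ?mulr_gt0// lnM ?posrE//.
lra.
Qed.

Lemma measurable_rel_ent d (T : measurableType d) (f g : T -> R) :
  measurable_fun setT f -> measurable_fun setT g ->
  measurable_fun setT (fun x => rel_ent (f x) (g x)).
Proof.
move=> mf mg; apply: measurable_funD.
  apply: measurable_funM => //; apply: (measurableT_comp (@measurable_ln R)).
  by apply: measurable_funM => //;
    exact: (measurableT_comp (@measurable_inv R)).
apply: measurable_fun_ifT => //; last exact: measurable_funB.
by apply: measurable_fun_eqr.
Qed.

End relative_entropy.

Section integral.
Context d (T : measurableType d) (R : realType) (mu : {measure set T ->
  \bar R}).

Lemma ge0_integralD_integrable (f : T -> \bar R) (g : T -> R) :
  measurable_fun setT f -> (forall x, 0 <= f x)%E ->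
  mu.-integrable setT (EFin \o g) ->
  (\int[mu]_x (f x + (g x)%:E) = \int[mu]_x f x + \int[mu]_x (g x)%:E)%E.
Proof.
move=> mf f0 ig; have mg := measurable_int _ ig.
have gfin : (\int[mu]_x (g x)%:E)%E \is a fin_num by exact: integrable_fin_num.
have [foo|foo] := eqVneq (\int[mu]_x f x)%E +oo%E; last first.
  rewrite integralD//; apply/integrableP; split=> //.
  under eq_integral do rewrite gee0_abs//.
  by rewrite ltey.
rewrite foo addye; last by apply: contraTneq gfin => ->.
set h := (fun x => f x + (g x)%:E)%E.
have mh : measurable_fun setT h by exact: emeasurable_funD.
have negl : (\int[mu]_x (h^\- x) < +oo)%E.
  apply: le_lt_trans (integral_funeneg_lt_pinfty measurableT ig).
  apply: ge0_le_integral => //; [exact: measurable_funeneg..|].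
  move=> x _; apply: (@funeneg_le _ _ setT (EFin \o g)); last exact/mem_set.
  by move=> y _ /=; exact: leeDr.
have : (\int[mu]_x f x <= \int[mu]_x (h^\+ x) + \int[mu]_x `|(g x)%:E|)%E.
  have mp := measurable_funepos mh.
  have ma : measurable_fun setT (fun x =>
    `|(g x)%:E|)%E by exact: measurableT_comp.
  rewrite -ge0_integralD//; apply: ge0_le_integral => //;
    first exact: emeasurable_funD.
  move=> x _; apply: (@le_trans _ _ (h x + `|(g x)%:E|)%E).
    rewrite /h -addeA leeDl// -EFinD lee_fin addrC -lerBlDr sub0r.
    by rewrite -normrN ler_norm.
  by rewrite leeD2r// funeposE/= le_max lexx.
rewrite foo leye_eq => /eqP; have /integrableP[_ absl] := ig.
move=> hg; have {}hp : (\int[mu]_x (h^\+ x) = +oo)%E.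
  move: hg absl; case: (\int[mu]_x (h^\+ x))%E => [r||]//;
  by case: (\int[mu]_x `|(g x)%:E|)%E.
rewrite integralE hp; have : (0 <= \int[mu]_x (h^\- x))%E by exact:
  integral_ge0.
by move: negl; case: (\int[mu]_x (h^\- x))%E.
Qed.

End integral.

Section entropy.
Context d (T : measurableType d) (R : realType) (mu : probability T R).
Implicit Types (f g : T -> R).

Let muT : (mu : {measure set T -> \bar R}) [set: T] = 1%E.
Proof. exact: probability_setT. Qed.

Lemma integral_cst1 (c : R) : (\int[mu]_x c%:E = c%:E)%E.
Proof. by rewrite integral_cst// muT mule1. Qed.

Lemma Rintegral_cst1 (c : R) : Rintegral mu setT (cst c) = c.
Proof. by rewrite Rintegral_cst// muT/= mulr1. Qed.

Lemma integral_EFin_Rintegral f : mu.-integrable setT (EFin \o f) ->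
  (\int[mu]_x (f x)%:E = (Rintegral mu setT f)%:E)%E.
Proof. by move=> fi; rewrite /Rintegral fineK//; exact: integrable_fin_num. Qed.

Lemma integrable_cst (c : R) : mu.-integrable setT (EFin \o cst c).
Proof. exact: finite_measure_integrable_cst. Qed.

Lemma integral_rel_ent g : (forall x, 0 <= g x) ->
  mu.-integrable setT (EFin \o g) ->
  (\int[mu]_x (g x * ln (g x / Rintegral mu setT g))%:E =
   \int[mu]_x (rel_ent (g x) (Rintegral mu setT g))%:E)%E.
Proof.
move=> g0 gi; set m := Rintegral mu setT g.
have mg : measurable_fun setT g by apply/measurable_EFinP;
  exact: measurable_int gi.
have m0 : 0 <= m by exact: Rintegral_ge0.
have [mz|mN0] := eqVneq m 0.
  by apply: eq_integral => x _; rewrite mz rel_ent0 invr0 mulr0 ln0// mulr0.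
have bi : mu.-integrable setT (EFin \o (fun x => g x - m)).
  rewrite (_ : _ \o _ = (EFin \o g) \- (EFin \o cst m))%E//.
  by apply: integrableB => //; exact: integrable_cst.
transitivity (\int[mu]_x ((rel_ent (g x) m)%:E + (g x - m)%:E))%E.
  apply: eq_integral => x _; rewrite rel_entE// -EFinD; congr (_%:E); ring.
rewrite ge0_integralD_integrable//; last 2 first.
- by apply/measurable_EFinP; exact: measurable_rel_ent.
- by move=> x; rewrite lee_fin rel_ent_ge0.
rewrite (_ : \int[mu]_x (g x - m)%:E = 0)%E ?adde0//.
rewrite integral_EFin_Rintegral// RintegralB//; last exact: integrable_cst.
by rewrite Rintegral_cst1 subrr.
Qed.

Lemma rel_ent_min g (w : R) : (forall x, 0 <= g x) ->
  mu.-integrable setT (EFin \o g) -> 0 <= w ->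
  (w = 0 -> Rintegral mu setT g = 0) ->
  (\int[mu]_x (rel_ent (g x) (Rintegral mu setT g))%:E <=
   \int[mu]_x (rel_ent (g x) w)%:E)%E.
Proof.
move=> g0 gi w0 wm; move: wm; set m := Rintegral mu setT g => wm.
have mg : measurable_fun setT g by apply/measurable_EFinP;
  exact: measurable_int gi.
have m0 : 0 <= m by exact: Rintegral_ge0.
have [mz|mN0] := eqVneq m 0.
  under eq_integral do rewrite mz rel_ent0.
  by rewrite integral0; apply: integral_ge0 => x _; rewrite lee_fin rel_ent_ge0.
have mp : 0 < m by rewrite lt_def mN0.
have wp : 0 < w by rewrite lt_def w0 andbT; apply: contra_neq mN0.
pose b x := g x * ln (m / w) + w - m.
have bi : mu.-integrable setT (EFin \o b).
  rewrite (_ : _ \o _ = (fun x =>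
    (ln (m / w)%R)%:E * (g x)%:E) \+ (EFin \o cst (w - m)%R))%E.
    apply: integrableD => //; last exact: integrable_cst.
    exact: integrableZl.
  by apply/funext => x; rewrite /b /= -EFinM -EFinD addrA mulrC.
rewrite [leRHS](_ : _ = \int[mu]_x ((rel_ent (g x) m)%:E + (b x)%:E))%E;
  last first.
  by apply: eq_integral => x _; rewrite -EFinD rel_ent_change.
rewrite ge0_integralD_integrable//; last 2 first.
- by apply/measurable_EFinP; exact: measurable_rel_ent.
- by move=> x; rewrite lee_fin rel_ent_ge0.
rewrite leeDl// integral_EFin_Rintegral// lee_fin.
have -> : Rintegral mu setT b = rel_ent m w.
  rewrite /b rel_entE ?gt_eqF//.
  under eq_Rintegral do rewrite -addrA.
  rewrite RintegralD//; last 2 first.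
  - rewrite (_ : _ \o _ = (fun x => (g x)%:E * (ln (m / w)%R)%:E))%E//.
    exact: integrableZr.
  - exact: integrable_cst.
  by rewrite RintegralZr// Rintegral_cst1.
exact: rel_ent_ge0.
Qed.

Lemma sqr_integrable f : measurable_fun setT f ->
  mu.-integrable setT (fun x => (f x ^+ 2)%:E) ->
    mu.-integrable setT (EFin \o f).
Proof.
move=> mf f2; apply: (@le_integrable _ _ _ _ _ _ _ (fun x =>
  1 + (f x ^+ 2)%:E)%E) => //.
- exact/measurable_EFinP.
- move=> x _; rewrite -EFinD lee_fin [leRHS]ger0_norm ?addr_ge0 ?sqr_ge0//.
  have : 0 <= (`|f x| - 1) ^+ 2 by exact: sqr_ge0.
  rewrite sqrrB1 real_normK ?num_real//.
  have := normr_ge0 (f x); lra.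
- by apply: integrableD => //; exact: (integrable_cst 1).
Qed.

Lemma integral_sqrB f (c : R) : measurable_fun setT f ->
  mu.-integrable setT (fun x => (f x ^+ 2)%:E) ->
  mu.-integrable setT (fun x => ((f x - c) ^+ 2)%:E) /\
  (\int[mu]_x ((f x - c) ^+ 2)%:E =
   (Rintegral mu setT (fun x => f x ^+ 2)
      - c * Rintegral mu setT f *+ 2 + c ^+ 2)%:E)%E.
Proof.
move=> mf f2; have fi := sqr_integrable mf f2.
have E1 : (fun x => ((f x - c) ^+ 2)%:E) =
    EFin \o (fun x => f x ^+ 2 + (- (c *+ 2) * f x + c ^+ 2)).
  by apply/funext => x /=; congr (_%:E); ring.
have cfi : mu.-integrable setT (EFin \o (fun x => - (c *+ 2) * f x)%R).
  rewrite (_ : _ \o _ = (fun x => (- (c *+ 2))%R%:E * (f x)%:E)%E)//.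
  exact: integrableZl.
have cfci : mu.-integrable setT (EFin \o (fun x =>
  - (c *+ 2) * f x + c ^+ 2)%R).
  rewrite (_ : _ \o _ = (EFin \o (fun x =>
    - (c *+ 2) * f x)%R) \+ (EFin \o cst (c ^+ 2)%R))%E//.
  by apply: integrableD => //; exact: integrable_cst.
have I : mu.-integrable setT (fun x => ((f x - c) ^+ 2)%:E).
  rewrite E1 (_ : _ \o _ = (fun x => (f x ^+ 2)%:E) \+
    (EFin \o (fun x => - (c *+ 2) * f x + c ^+ 2)%R))%E//.
  exact: integrableD.
split=> //; rewrite integral_EFin_Rintegral//; congr (_%:E).
rewrite (@eq_Rintegral _ _ _ mu setT (fun x =>
  f x ^+ 2 + (- (c *+ 2) * f x + c ^+ 2))); last first.
  by move=> x _; ring.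
rewrite RintegralD// RintegralD//; last exact: integrable_cst.
rewrite RintegralZl// Rintegral_cst1; ring.
Qed.

Lemma variance_eq f : measurable_fun setT f ->
  mu.-integrable setT (fun x => (f x ^+ 2)%:E) ->
  ((\int[mu]_x (f x ^+ 2)%:E) - (Rintegral mu setT f ^+ 2)%:E =
   \int[mu]_x ((f x - Rintegral mu setT f) ^+ 2)%:E)%E.
Proof.
move=> mf f2; have [_ ->] := integral_sqrB (Rintegral mu setT f) mf f2.
rewrite integral_EFin_Rintegral// -EFinB; congr (_%:E); ring.
Qed.

Lemma variance_le f (c : R) : measurable_fun setT f ->
  mu.-integrable setT (fun x => (f x ^+ 2)%:E) ->
  ((\int[mu]_x (f x ^+ 2)%:E) - (Rintegral mu setT f ^+ 2)%:E <=
   \int[mu]_x ((f x - c) ^+ 2)%:E)%E.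
Proof.
move=> mf f2; have [_ ->] := integral_sqrB c mf f2.
rewrite integral_EFin_Rintegral// -EFinB lee_fin.
have := sqr_ge0 (Rintegral mu setT f - c); lra.
Qed.

(* [rel_ent] dominates the Hellinger distance:
   [f^2 ln (f^2 / N^2) >= 2 f^2 - 2 N f]. *)
Lemma variance_le_entropy f : measurable_fun setT f -> (forall x, 0 < f x) ->
  mu.-integrable setT (fun x => (f x ^+ 2)%:E) ->
  ((\int[mu]_x (f x ^+ 2)%:E) - (Rintegral mu setT f ^+ 2)%:E <=
   \int[mu]_x (f x ^+ 2 *
     ln (f x ^+ 2 / Rintegral mu setT (fun y => f y ^+ 2)%R))%:E)%E.
Proof.
move=> mf f0 f2; set m := Rintegral mu setT (fun y => f y ^+ 2).
have m0 : 0 <= m by apply: Rintegral_ge0 => x _; exact: sqr_ge0.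
apply: (le_trans (variance_le (Num.sqrt m) mf f2)).
rewrite [leRHS]integral_rel_ent -/m; last 2 first.
- by move=> x; exact: sqr_ge0.
- exact: f2.
have [mz|mN0] := eqVneq m 0.
  under eq_integral do rewrite mz sqrtr0 subr0.
  under [leRHS]eq_integral do rewrite mz rel_ent0.
  by rewrite integral0 integral_EFin_Rintegral// -/m mz.
have mp : 0 < m by rewrite lt_def mN0.
have N0 : 0 < Num.sqrt m by rewrite sqrtr_gt0.
have mf2 : measurable_fun setT (fun x => f x ^+ 2) by exact: measurable_funX.
apply: ge0_le_integral => //.
- by move=> x _; rewrite lee_fin sqr_ge0.
- by apply/measurable_EFinP/measurable_funX/measurable_funB.
- by apply/measurable_EFinP; exact: measurable_rel_ent.
- move=> x _; rewrite lee_fin rel_entE//.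
  have -> : ln (f x ^+ 2 / m) = ln (f x / Num.sqrt m) *+ 2.
    by rewrite -lnXn ?divr_gt0// expr_div_n sqr_sqrtr.
  rewrite -[X in X - f x ^+ 2](sqr_sqrtr m0).
  have := ler_wpM2l (ltW (f0 x)) (le_mul_ln (ltW (f0 x)) N0).
  move: (Num.sqrt m) (ln _) => N L; lra.
Qed.

End entropy.

Section tensor.
Context d1 d2 (T1 : measurableType d1) (T2 : measurableType d2) (R : realType).
Variables (mu1 : probability T1 R) (mu2 : probability T2 R).
Variable g : T1 * T2 -> R.
Hypothesis g0 : forall p, 0 <= g p.
Hypothesis gi : (mu1 \x mu2)%E.-integrable setT (EFin \o g).

Let F x := Rintegral mu2 setT (fun y => g (x, y)).
Let G y := Rintegral mu1 setT (fun x => g (x, y)).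
Let m := Rintegral (mu1 \x mu2)%E setT g.

Let mgE : measurable_fun setT (EFin \o g). Proof. exact: measurable_int gi. Qed.
Let mg : measurable_fun setT g. Proof. exact/measurable_EFinP. Qed.
Let gE0 p : (0 <= (EFin \o g) p)%E. Proof. by rewrite lee_fin. Qed.

Let F0 x : 0 <= F x. Proof. exact: Rintegral_ge0. Qed.
Let G0 y : 0 <= G y. Proof. exact: Rintegral_ge0. Qed.
Let m0 : 0 <= m. Proof. exact: Rintegral_ge0. Qed.

Let mF : measurable_fun setT F.
Proof.
apply: (measurableT_comp (fine_measurable measurableT)).
exact: (measurable_fun_fubini_tonelli_F (m2 := mu2) (EFin \o g) mgE gE0).
Qed.

Let mG : measurable_fun setT G.
Proof.
apply: (measurableT_comp (fine_measurable measurableT)).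
exact: (measurable_fun_fubini_tonelli_G (m1 := mu1) (EFin \o g) mgE gE0).
Qed.

Let aeF : {ae mu1, forall x, (\int[mu2]_y (g (x, y))%:E = (F x)%:E)%E}.
Proof.
have := ae_integrable1 gi; apply: filterS => x.
exact: integral_EFin_Rintegral.
Qed.

Let aeG : {ae mu2, forall y, (\int[mu1]_x (g (x, y))%:E = (G y)%:E)%E}.
Proof.
have := ae_integrable2 gi; apply: filterS => y.
exact: integral_EFin_Rintegral.
Qed.

Let intg : (\int[mu1 \x mu2]_p (g p)%:E = m%:E)%E.
Proof. exact: integral_EFin_Rintegral. Qed.

Let intF : (\int[mu1]_x (F x)%:E = m%:E)%E.
Proof.
rewrite -intg (fubini_tonelli1 (EFin \o g))//.
apply: ae_eq_integral => //; first exact/measurable_EFinP.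
  exact: (measurable_fun_fubini_tonelli_F (m2 := mu2) (EFin \o g) mgE gE0).
by apply: filterS aeF => x + _; rewrite /fubini_F => ->.
Qed.

Let intG : (\int[mu2]_y (G y)%:E = m%:E)%E.
Proof.
rewrite -intg (fubini_tonelli2 (EFin \o g))//.
apply: ae_eq_integral => //; first exact/measurable_EFinP.
  exact: (measurable_fun_fubini_tonelli_G (m1 := mu1) (EFin \o g) mgE gE0).
by apply: filterS aeG => y + _; rewrite /fubini_G => ->.
Qed.

Let mF1 : measurable_fun setT (fun p : T1 * T2 => F p.1).
Proof. exact: (measurableT_comp mF measurable_fst). Qed.

Let mG2 : measurable_fun setT (fun p : T1 * T2 => G p.2).
Proof. exact: (measurableT_comp mG measurable_snd). Qed.

Let nullF : {ae (mu1 \x mu2)%E, forall p, F p.1 = 0 -> g p = 0}.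
Proof.
pose k (p : T1 * T2) := (if F p.1 == 0 then g p else 0)%:E.
have k0 p : (0 <= k p)%E by rewrite lee_fin; case: ifP.
have mk : measurable_fun setT k.
  apply/measurable_EFinP/measurable_fun_ifT => //.
  exact: measurable_fun_eqr.
have : (\int[mu1 \x mu2]_p `|k p| = 0)%E.
  under eq_integral do rewrite gee0_abs//.
  rewrite (fubini_tonelli1 k)// -[RHS](integral0 mu1 setT).
  apply: ae_eq_integral => //;
    first exact: (measurable_fun_fubini_tonelli_F (m2 := mu2) k mk k0).
  apply: filterS aeF => x Fx _; rewrite /fubini_F /k/=.
  have [Fz|_] := eqVneq (F x) 0; first by rewrite Fx Fz.
  by rewrite integral0.
move=> /(ae_eq_integral_abs _ measurableT mk).
apply: filterS => p /(_ I); rewrite /k => /= + Fp.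
by rewrite Fp eqxx => -[].
Qed.

Let nullG : {ae (mu1 \x mu2)%E, forall p, G p.2 = 0 -> g p = 0}.
Proof.
pose k (p : T1 * T2) := (if G p.2 == 0 then g p else 0)%:E.
have k0 p : (0 <= k p)%E by rewrite lee_fin; case: ifP.
have mk : measurable_fun setT k.
  apply/measurable_EFinP/measurable_fun_ifT => //.
  exact: measurable_fun_eqr.
have : (\int[mu1 \x mu2]_p `|k p| = 0)%E.
  under eq_integral do rewrite gee0_abs//.
  rewrite (fubini_tonelli2 k)// -[RHS](integral0 mu2 setT).
  apply: ae_eq_integral => //;
    first exact: (measurable_fun_fubini_tonelli_G (m1 := mu1) k mk k0).
  apply: filterS aeG => y Gy _; rewrite /fubini_G /k/=.
  have [Gz|_] := eqVneq (G y) 0; first by rewrite Gy Gz.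
  by rewrite integral0.
move=> /(ae_eq_integral_abs _ measurableT mk).
apply: filterS => p /(_ I); rewrite /k => /= + Gp.
by rewrite Gp eqxx => -[].
Qed.

Lemma rel_ent_tensor :
  (\int[mu1 \x mu2]_p (rel_ent (g p) m)%:E <=
   \int[mu2]_y \int[mu1]_x (rel_ent (g (x, y)) (G y))%:E +
   \int[mu1]_x \int[mu2]_y (rel_ent (g (x, y)) (F x))%:E)%E.
Proof.
have [mz|mN0] := eqVneq m 0.
  under eq_integral do rewrite mz rel_ent0.
  rewrite integral0; apply: adde_ge0; apply: integral_ge0 => ? _;
    by apply: integral_ge0 => ? _; rewrite lee_fin rel_ent_ge0.
have mp : 0 < m by rewrite lt_def mN0.
pose A p := (rel_ent (g p) m)%:E; pose B p := (rel_ent (g p) (G p.2))%:E.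
pose C p := (rel_ent (g p) (F p.1))%:E.
have mA : measurable_fun setT A by apply/measurable_EFinP;
  exact: measurable_rel_ent.
have mB : measurable_fun setT B by apply/measurable_EFinP;
  exact: measurable_rel_ent.
have mC : measurable_fun setT C by apply/measurable_EFinP;
  exact: measurable_rel_ent.
have A0 p : (0 <= A p)%E by rewrite lee_fin rel_ent_ge0.
have B0 p : (0 <= B p)%E by rewrite lee_fin rel_ent_ge0.
have C0 p : (0 <= C p)%E by rewrite lee_fin rel_ent_ge0.
have mFE : measurable_fun setT (fun p : T1 * T2 =>
  (F p.1)%:E) by exact/measurable_EFinP.
have mGE : measurable_fun setT (fun p : T1 * T2 =>
  (G p.2)%:E) by exact/measurable_EFinP.
have iF : (\int[mu1 \x mu2]_p (F p.1)%:E = m%:E)%E.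
  rewrite (fubini_tonelli1 (fun p => (F p.1)%:E))//; last by move=> p;
    rewrite lee_fin.
  rewrite -[RHS]intF.
  by apply: eq_integral => x _; rewrite /fubini_F/= integral_cst1.
have iG : (\int[mu1 \x mu2]_p (G p.2)%:E = m%:E)%E.
  rewrite (fubini_tonelli2 (fun p => (G p.2)%:E))//; last by move=> p;
    rewrite lee_fin.
  rewrite -[RHS]intG.
  by apply: eq_integral => x _; rewrite /fubini_G/= integral_cst1.
pose D (p : T1 * T2) := (m + F p.1 * G p.2 / m)%:E.
have D0 p : (0 <= D p)%E by rewrite lee_fin addr_ge0// divr_ge0// mulr_ge0.
have mD : measurable_fun setT D.
  by apply/measurable_EFinP/measurable_funD => //;
    do 2 apply: measurable_funM => //.
have iD : (\int[mu1 \x mu2]_p D p = (m + m)%:E)%E.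
  rewrite (fubini_tonelli1 D)//.
  transitivity (\int[mu1]_x (m + F x)%:E)%E.
    apply: eq_integral => x _; rewrite /fubini_F /D/=.
    under eq_integral do rewrite EFinD mulrAC EFinM.
    rewrite ge0_integralD//; last 2 first.
      by move=> y _; rewrite -EFinM lee_fin mulr_ge0// divr_ge0.
      apply: emeasurable_funM => //; exact/measurable_EFinP.
    rewrite integral_cst1 ge0_integralZl//; last 3 first.
      by apply/measurable_EFinP.
      by move=> y _; rewrite lee_fin.
      by rewrite lee_fin divr_ge0.
    by rewrite intG -EFinM divfK// -EFinD.
  under eq_integral do rewrite EFinD.
  rewrite ge0_integralD//; last 2 first.
    by move=> y _; rewrite lee_fin.
    exact/measurable_EFinP.
  by rewrite integral_cst1 intF -EFinD.
have : (\int[mu1 \x mu2]_p (A p + (F p.1)%:E + (G p.2)%:E) <=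
        \int[mu1 \x mu2]_p (B p + C p + D p))%E.
  apply: ae_ge0_le_integral => //.
  - by move=> p _; rewrite !adde_ge0// lee_fin.
  - by do 2 apply: emeasurable_funD => //.
  - by move=> p _; rewrite !adde_ge0// lee_fin.
  - by do 2 apply: emeasurable_funD => //.
  apply: filterS2 nullF nullG => p Fg Gg _.
  by rewrite lee_fin rel_ent_subadditive.
have F0E p : (0 <= (F p.1)%:E)%E by rewrite lee_fin.
have G0E p : (0 <= (G p.2)%:E)%E by rewrite lee_fin.
have AF0 p : (0 <= A p + (F p.1)%:E)%E by exact: adde_ge0.
have BC0 p : (0 <= B p + C p)%E by exact: adde_ge0.
rewrite (@ge0_integralD _ _ _ _ _ _ (fun p => A p + (F p.1)%:E)%E)//;
  last exact: emeasurable_funD.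
rewrite (@ge0_integralD _ _ _ _ _ _ A)// (@ge0_integralD _ _ _ _ _ _ (B \+
  C)%E)//; last exact: emeasurable_funD.
rewrite (@ge0_integralD _ _ _ _ _ _ B)//.
rewrite iF iG iD -addeA -EFinD leeD2rE//.
by rewrite (fubini_tonelli2 B)// (fubini_tonelli1 C).
Qed.

Lemma rel_ent_tensor_le (K1 K2 : T1 * T2 -> \bar R) (D : R) :
  measurable_fun setT K1 -> measurable_fun setT K2 ->
  (forall p, 0 <= K1 p)%E -> (forall p, 0 <= K2 p)%E -> 0 <= D ->
  {ae mu2, forall y, (\int[mu1]_x (rel_ent (g (x, y)) (G y))%:E <=
                      D%:E * \int[mu1]_x K1 (x, y))%E} ->
  {ae mu1, forall x, (\int[mu2]_y (rel_ent (g (x, y)) (F x))%:E <=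
                      D%:E * \int[mu2]_y K2 (x, y))%E} ->
  (\int[mu1 \x mu2]_p (rel_ent (g p) m)%:E <=
   D%:E * \int[mu1 \x mu2]_p (K1 p + K2 p))%E.
Proof.
move=> mK1 mK2 K10 K20 D0 le1 le2; apply: (le_trans rel_ent_tensor).
rewrite (@ge0_integralD _ _ _ _ _ _ K1 K2)// ge0_muleDr;
  [|exact: integral_ge0..].
rewrite (fubini_tonelli2 K1)// (fubini_tonelli1 K2)//.
have mr1 : measurable_fun setT (fun p : T1 * T2 => (rel_ent (g p) (G p.2))%:E).
  by apply/measurable_EFinP; exact: measurable_rel_ent.
have mr2 : measurable_fun setT (fun p : T1 * T2 => (rel_ent (g p) (F p.1))%:E).
  by apply/measurable_EFinP; exact: measurable_rel_ent.
have r10 p : (0 <= (rel_ent (g p) (G p.2))%:E)%E by rewrite lee_fin rel_ent_ge0.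
have r20 p : (0 <= (rel_ent (g p) (F p.1))%:E)%E by rewrite lee_fin rel_ent_ge0.
have iK1 y : (0 <= fubini_G mu1 K1 y)%E by exact: integral_ge0.
have iK2 x : (0 <= fubini_F mu2 K2 x)%E by exact: integral_ge0.
have miK1 := measurable_fun_fubini_tonelli_G (m1 := mu1) K1 mK1 K10.
have miK2 := measurable_fun_fubini_tonelli_F (m2 := mu2) K2 mK2 K20.
apply: leeD; rewrite -ge0_integralZl//.
- apply: ae_ge0_le_integral => //.
  + by move=> y _; apply: integral_ge0 => x _; exact: (r10 (x, y)).
  + exact: (measurable_fun_fubini_tonelli_G (m1 := mu1) _ mr1 r10).
  + by move=> y _; rewrite mule_ge0// lee_fin.
  + by apply: emeasurable_funM.
  + by apply: filterS le1 => y h _.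
- apply: ae_ge0_le_integral => //.
  + by move=> x _; apply: integral_ge0 => y _; exact: (r20 (x, y)).
  + exact: (measurable_fun_fubini_tonelli_F (m2 := mu2) _ mr2 r20).
  + by move=> x _; rewrite mule_ge0// lee_fin.
  + by apply: emeasurable_funM.
  + by apply: filterS le2 => x h _.
Qed.

End tensor.

(** * Variance *)

Section variance_fatou.
Context d (T : measurableType d) (R : realType) (mu : probability T R).
Implicit Types f g : T -> R.

Definition sqr_variance f : \bar R :=
  ((\int[mu]_x (f x ^+ 2)%:E) - (Rintegral mu setT f ^+ 2)%:E)%E.

Lemma variance_centered f : measurable_fun setT f ->
  mu.-integrable setT (fun x => (f x ^+ 2)%:E) ->
  (sqr_variance f = \int[mu]_x ((f x - Rintegral mu setT f) ^+ 2)%:E)%E.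
Proof. exact: variance_eq. Qed.

Let measurable_sqrB f : measurable_fun setT f ->
  measurable_fun setT (fun p : T * T => ((f p.1 - f p.2) ^+ 2)%:E).
Proof.
move=> mf; apply/measurable_EFinP/measurable_funX/measurable_funB.
  exact: (measurableT_comp mf measurable_fst).
exact: (measurableT_comp mf measurable_snd).
Qed.

Let sqrB_ge0 f (p : T * T) : (0 <= ((f p.1 - f p.2) ^+ 2)%:E)%E.
Proof. by rewrite lee_fin sqr_ge0. Qed.

Lemma variance_prod f : measurable_fun setT f ->
  mu.-integrable setT (fun x => (f x ^+ 2)%:E) ->
  (\int[mu \x mu]_p ((f p.1 - f p.2) ^+ 2)%:E = sqr_variance f + sqr_variance
    f)%E.
Proof.
move=> mf f2; rewrite (fubini_tonelli1 (fun p => ((f p.1 - f p.2) ^+ 2)%:E));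
  last 2 first.
- exact: measurable_sqrB.
- exact: sqrB_ge0.
set m1 := Rintegral mu setT f; set m2 := Rintegral mu setT (fun x => f x ^+ 2).
have vE : sqr_variance f = (m2 - m1 ^+ 2)%:E by rewrite /sqr_variance
  integral_EFin_Rintegral.
have v0 : 0 <= m2 - m1 ^+ 2.
  rewrite -lee_fin -vE /sqr_variance variance_eq//; apply: integral_ge0 => x _.
  by rewrite lee_fin sqr_ge0.
transitivity (\int[mu]_x (((f x - m1) ^+ 2)%:E + (m2 - m1 ^+ 2)%:E))%E.
  apply: eq_integral => x _; rewrite /fubini_F/=.
  under eq_integral do rewrite -sqrrN opprB.
  by have [_ ->] := integral_sqrB (f x) mf f2; rewrite -EFinD; congr (_%:E);
    rewrite -/m1 -/m2; ring.
rewrite ge0_integralD//; last 2 first.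
- by move=> x _; rewrite lee_fin sqr_ge0.
- by apply/measurable_EFinP/measurable_funX/measurable_funB.
by rewrite integral_cst1 -variance_eq// -/(sqr_variance f) vE.
Qed.

Lemma integrable_sqr_prod f : measurable_fun setT f ->
  (\int[mu \x mu]_p ((f p.1 - f p.2) ^+ 2)%:E < +oo)%E ->
  mu.-integrable setT (fun x => (f x ^+ 2)%:E).
Proof.
move=> mf foo.
have fi : (mu \x mu)%E.-integrable setT (fun p : T * T =>
  ((f p.1 - f p.2) ^+ 2)%:E).
  apply/integrableP; split; first exact: measurable_sqrB.
  by under eq_integral do rewrite gee0_abs ?sqrB_ge0//.
have mu0 : (0 < (mu : {measure set T -> \bar R}) setT)%E.
  by rewrite [X in (_ < X)%E]probability_setT.
have [x /= fx] := @filter_ex _ _ (ae_properfilter_algebraOfSetsType mu0) _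
  (ae_integrable1 fi).
have mf2 : measurable_fun setT (fun x => (f x ^+ 2)%:E).
  by apply/measurable_EFinP; exact: measurable_funX.
apply: (@le_integrable _ _ _ _ _ _ _
    (fun y => 2%:E * ((f x - f y) ^+ 2)%:E + (2 * f x ^+ 2)%:E)%E) => //.
- move=> y _; rewrite -EFinM -EFinD lee_fin !ger0_norm ?sqr_ge0//.
    have := sqr_ge0 (f x + (f x - f y)); nra.
  by rewrite addr_ge0// mulr_ge0// sqr_ge0.
- apply: integrableD => //; first exact: integrableZl.
  exact: integrable_cst.
Qed.

Lemma variance_fatou (f : T -> R) (f_ : nat -> T -> R) (L : R) (L_ : nat -> R) :
  measurable_fun setT f -> (forall k, measurable_fun setT (f_ k)) ->
  (forall k, mu.-integrable setT (fun x => (f_ k x ^+ 2)%:E)) ->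
  (forall x, f_ k x @[k --> \oo] --> f x) -> L_ k @[k --> \oo] --> L ->
  (forall k, sqr_variance (f_ k) <= (L_ k)%:E)%E -> (sqr_variance f <= L%:E)%E.
Proof.
move=> mf mf_ f_2 f_f L_L vL.
have F : (\int[mu \x mu]_p ((f p.1 - f p.2) ^+ 2)%:E <= (L + L)%:E)%E.
  have -> : (\int[mu \x mu]_p ((f p.1 - f p.2) ^+ 2)%:E =
      \int[mu \x mu]_p limn_einf (fun k => ((f_ k p.1 - f_ k p.2) ^+ 2)%:E))%E.
    apply: eq_integral => p _; apply/esym.
    apply: (cvg_limn_einf_sup _).1; apply/cvg_EFin; first exact: nearW.
    apply: (@cvgM _ _ \oo); apply: cvgB; exact: f_f.
  apply: (@le_trans _ _ (limn_einf (fun k =>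
      \int[mu \x mu]_p ((f_ k p.1 - f_ k p.2) ^+ 2)%:E))%E).
    by apply: fatou => // k; exact: measurable_sqrB.
  have LL : (L_ k + L_ k)%:E @[k --> \oo] --> (L + L)%:E.
    by apply/cvg_EFin; [exact: nearW|exact: cvgD].
  rewrite limn_einf_lim -(cvg_lim _ LL)//; apply: lee_lim.
  - exact: is_cvg_einfs.
  - by apply/cvg_ex; exists (L + L)%:E.
  apply: nearW => k; apply: (@le_trans _ _ (sqr_variance (f_ k) + sqr_variance
    (f_ k))%E).
    rewrite -variance_prod//; apply: ereal_inf_lbound; exists k => //=.
  by rewrite EFinD; apply: leeD.
have f2 := integrable_sqr_prod mf (le_lt_trans F (ltry _)).
move: F; rewrite variance_prod// /sqr_variance integral_EFin_Rintegral//.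
by rewrite -EFinB -EFinD !lee_fin; lra.
Qed.

End variance_fatou.

(** * A smooth cutoff *)

Section flat.
Context {R : realType}.
Implicit Types (p q : {poly R}) (t u : R).

(* [p(1/t) exp(-1/t)] extended by 0 to [t <= 0]: a family closed under
   derivation, whose member [p = 1] is the standard flat function. *)
Definition flat p t : R := if 0 < t then p.[t^-1] * expR (- t^-1) else 0.

Lemma exprn_expRN_le k u : 0 <= u -> u ^+ k * expR (- u) <= k%:R ^+ k.
Proof.
move=> u0; rewrite expRN ler_pdivrMr ?expR_gt0//.
case: k => [|k]; first by rewrite !expr0 mul1r -expR0 ler_expR.
have -> : expR u = expR (u / k.+1%:R) ^+ k.+1.
  by rewrite -expRM_natl mulrCA divff ?mulr1 ?pnatr_eq0.
rewrite -exprMn lerXn2r ?nnegrE ?mulr_ge0 ?expR_ge0//.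
rewrite mulrC -ler_pdivrMr ?ltr0n//.
by apply: le_trans (expR_ge1Dx _); rewrite lerDr.
Qed.

Lemma flat_bounded p : exists K, forall t, `|flat p t| <= K.
Proof.
suff /(_ 0%N)[K pK] k : exists K, forall u, 0 <= u ->
  `|p.[u]| * (u ^+ k * expR (- u)) <= K.
  exists (Num.max 0 K) => t; rewrite /flat le_max; case: ifPn => [t0|_].
    have ti : 0 <= t^-1 by rewrite invr_ge0 ltW.
    apply/orP; right; have := pK _ ti.
    by rewrite expr0 mul1r normrM (ger0_norm (expR_ge0 _)).
  by rewrite normr0 lexx.
elim/poly_ind: p k => [|p c ih] k.
  by exists 0 => u _; rewrite horner0 normr0 mul0r.
have [K pK] := ih k.+1; exists (K + `|c| * k%:R ^+ k) => u u0.
have e0 : 0 <= u ^+ k * expR (- u) by rewrite mulr_ge0 ?exprn_ge0 ?expR_ge0.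
rewrite hornerMXaddC.
apply: (le_trans (ler_wpM2r e0 (ler_normD _ _))).
rewrite mulrDl lerD//; last by rewrite ler_wpM2l// exprn_expRN_le.
by have := pK u u0; rewrite exprS normrM (ger0_norm u0) !mulrA.
Qed.

Lemma flatX p t : flat p t = flat ('X * p) t * t.
Proof.
rewrite /flat; case: ifPn => [t0|]; last by rewrite mul0r.
by rewrite hornerM hornerX; field; rewrite gt_eqF.
Qed.

Lemma flat0 p : flat p 0 = 0. Proof. by rewrite /flat ltxx. Qed.

Lemma flat_continuous0 p : {for 0, continuous (flat p)}.
Proof.
suff : flat p t @[t --> (0 : R)] --> (0 :
  R) by rewrite -[X in _ --> X](flat0 p).
have [K pK] := flat_bounded ('X * p).
have K0 : 0 <= K by exact: le_trans (pK 0).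
apply/cvgr0Pnorm_le => e e0; near=> t.
rewrite flatX normrM (le_trans (ler_wpM2r _ (pK t)))//.
apply: (@le_trans _ _ ((K + 1) * `|t|)); first by rewrite ler_wpM2r// lerDl.
rewrite mulrC -ler_pdivlMr ?ltr_wpDl//.
near: t; apply: (@cvgr0_norm_le _ _ _ _ _ id) => //.
by rewrite divr_gt0// ltr_wpDl.
Unshelve. all: by end_near. Qed.

Lemma is_derive_flat p t : is_derive t 1 (flat p) (flat ('X^2 * (p - p^`())) t).
Proof.
have [t0|t0|->] := ltgtP t 0.
- rewrite {2}/flat ltNge (ltW t0)/=.
  apply: (@near_eq_is_derive _ _ _ (cst 0)) => //.
  near=> s; rewrite /flat ifN// -leNgt ltW//.
  by near: s; exact: lt_nbhsl.
- pose g (s : R) := p.[s^-1] * expR (- s^-1).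
  have fg : \near t, g t = flat p t.
    near=> s; rewrite /flat ifT//; near: s; exact: lt_nbhsr.
  apply: (near_eq_is_derive fg).
  have dV : is_derive t 1 (fun s : R => s^-1) (- t ^- 2).
    have := @is_deriveV _ id t 1 1; rewrite gt_eqF// => /(_ isT).
    by move=> h; have := h _; rewrite [_ *: _]mulr1; apply.
  have dp := is_derive1_comp (is_derive_poly p t^-1) dV.
  have dNV : is_derive t 1 (fun s : R =>
    - s^-1) (- - t ^- 2) by exact: is_deriveN.
  have de := @is_derive1_comp _ expR (fun s =>
    - s^-1) t _ _ (is_derive_expR _) dNV.
  have := is_deriveM dp de.
  rewrite /flat t0 !hornerE /= opprK => h; apply: is_derive_eq.
  rewrite /GRing.scale/= exprVn; ring.
- apply/is_derive1_caratheodory; exists (flat ('X * p)); split.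
  + by move=> z; rewrite flat0 !subr0 flatX.
  + exact: flat_continuous0.
  + by rewrite !flat0.
Unshelve. all: by end_near. Qed.

Fixpoint flat_poly (k : nat) : {poly R} :=
  if k is k'.+1 then 'X^2 * (flat_poly k' - (flat_poly k')^`()) else 1.

Definition flat_derivative (k : nat) (t : R) : R := flat (flat_poly k) t.

Lemma derivatives_flat : derivatives flat_derivative.
Proof. by move=> k t; exact: is_derive_flat. Qed.

Lemma flat_derivative_bounded k :
  exists K, forall t, `|flat_derivative k t| <= K.
Proof. exact: flat_bounded. Qed.

Lemma flat_derivative_eq0 k t : t <= 0 -> flat_derivative k t = 0.
Proof. by rewrite /flat_derivative /flat leNgt => /negbTE ->. Qed.

Lemma flat_derivative01 : flat_derivative 0 1 = expR (- 1).
Proof. by rewrite /flat_derivative /flat ltr01 hornerE mul1r invr1. Qed.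

End flat.

Section cutoff.
Context {R : realType} {n : nat}.
Implicit Types (f : 'rV[R]_n -> R) (x : 'rV[R]_n) (r : R).

Definition paraboloid r : 'rV[R]_n -> R :=
  cst 1 \+ (fun x => \sum_(j < n) (cst (- r ^+ 2) \* ((fun y =>
    y 0 j) \* (fun y => y 0 j))) x).

Lemma paraboloidE r x : paraboloid r x = 1 - \sum_(j < n) (r * x 0 j) ^+ 2.
Proof.
rewrite /paraboloid/= -sumrN; congr (_ + _); apply: eq_bigr => j _; ring.
Qed.

Let smooth_sqr j : smooth ((fun y : 'rV[R]_n => y 0 j) \* (fun y => y 0 j)).
Proof. by apply: smoothM; exact: smooth_coord. Qed.

Let smooth_csqr r j :
  smooth (cst (- r ^+ 2) \* ((fun y : 'rV[R]_n => y 0 j) \* (fun y => y 0 j))).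
Proof. by apply: smoothM; [exact: smooth_cst|exact: smooth_sqr]. Qed.

Lemma smooth_paraboloid r : smooth (paraboloid r).
Proof. by apply: smoothD; [exact: smooth_cst|apply: smooth_sum => j;
  exact: smooth_csqr]. Qed.

Let partial_csqr r i j x :
  partial i (cst (- r ^+ 2) \* ((fun y : 'rV[R]_n => y 0 j) \* (fun y =>
    y 0 j))) x =
  - (2 * r ^+ 2 * x 0 j) * (i == j)%:R.
Proof.
rewrite partialM; [|exact: smooth_cst|exact: smooth_sqr].
rewrite partialM; [|exact: smooth_coord..].
by rewrite partial_coord partial_cst/=; ring.
Qed.

Lemma partial_paraboloid r i x :
  partial i (paraboloid r) x = - (2 * r ^+ 2 * x 0 i).
Proof.
rewrite partialD; [|exact: smooth_cst|apply: smooth_sum => j;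
  exact: smooth_csqr].
rewrite partial_cst add0r partial_sum; last by move=> j; exact: smooth_csqr.
rewrite (bigD1 i)//= big1 ?addr0 => [|j ji]; rewrite partial_csqr.
  by rewrite eqxx mulr1.
by rewrite eq_sym (negbTE ji) mulr0.
Qed.

Lemma paraboloid_gt0 r i x : 0 < paraboloid r x -> `|r * x 0 i| <= 1.
Proof.
rewrite paraboloidE subr_gt0 => h.
rewrite -(@ler_pXn2r _ 2)// ?nnegrE// expr1n real_normK ?num_real//.
apply: le_trans (ltW h); rewrite (bigD1 i)//= lerDl.
by apply: sumr_ge0 => j _; exact: sqr_ge0.
Qed.

Definition cutoff r : 'rV[R]_n -> R :=
  cst (expR 1) \* (flat_derivative 0 \o paraboloid r).

Let smooth_bump r : smooth (flat_derivative 0 \o paraboloid r).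
Proof. by apply: smooth_comp;
  [exact: derivatives_flat|exact: smooth_paraboloid]. Qed.

Lemma smooth_cutoff r : smooth (cutoff r).
Proof. by apply: smoothM; [exact: smooth_cst|exact: smooth_bump]. Qed.

Lemma cutoff_eq0 r x : paraboloid r x <= 0 -> cutoff r x = 0.
Proof. by move=> h; rewrite /cutoff/= flat_derivative_eq0// mulr0. Qed.

Lemma norm_cutoff r x : `|cutoff r x| <= 1.
Proof.
rewrite /cutoff/= /flat_derivative /flat; case: ifP => [h|_];
  last by rewrite mulr0 normr0.
rewrite /= hornerC mul1r -expRD ger0_norm ?expR_ge0// -[leRHS]expR0 ler_expR
  subr_le0.
rewrite invf_ge1// paraboloidE gerBl.
by apply: sumr_ge0 => j _; exact: sqr_ge0.
Qed.

Lemma partial_cutoff_le : exists K, forall r i x,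
  `|partial i (cutoff r) x| <= K * `|r|.
Proof.
have [K bK] := @flat_derivative_bounded R 1.
have K0 : 0 <= K by exact: le_trans (bK 0).
exists (expR 1 * K * 2) => r i x.
rewrite partialM; [|exact: smooth_cst|exact: smooth_bump].
rewrite partial_cst mulr0 addr0 partial_comp;
  [|exact: derivatives_flat|exact: smooth_paraboloid].
rewrite partial_paraboloid normrM (ger0_norm (expR_ge0 _)) -!mulrA ler_pM2l
  ?expR_gt0//.
have [q0|q0] := leP (paraboloid r x) 0.
  by rewrite flat_derivative_eq0// mul0r normr0 mulr_ge0// mulr_ge0.
rewrite normrM ler_pM// normrN (_ : 2 * _ = 2 * r * (r * x 0 i)); last by ring.
rewrite normrM normrM ger0_norm//.
by rewrite ler_piMr ?mulr_ge0//; exact: paraboloid_gt0.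
Qed.

Lemma cutoff_cvg (r : nat -> R) x : r k @[k --> \oo] --> 0 ->
  cutoff (r k) x @[k --> \oo] --> (1 : R).
Proof.
move=> r0; rewrite /cutoff/=.
rewrite [X in _ --> X](_ : 1 = expR 1 * flat_derivative 0 1); last first.
  by rewrite flat_derivative01 -expRD subrr expR0.
apply: cvgM; first exact: cvg_cst.
apply: (cvg_comp _ _ (_ : paraboloid (r k) x @[k --> \oo] --> (1 : R))).
  pose S := \sum_(j < n) x 0 j ^+ 2.
  have qE k : paraboloid (r k) x = 1 - r k * r k * S.
    rewrite paraboloidE mulr_sumr; congr (_ - _).
    by apply: eq_bigr => j _; rewrite exprMn expr2.
  have : (1 - r k * r k * S) @[k --> \oo] --> 1 - 0 * 0 * S.
    apply: cvgB; first exact: cvg_cst.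
    by apply: cvgM; [exact: cvgM|exact: cvg_cst].
  by rewrite mulr0 mul0r subr0 (_ : (fun k => _) = fun k =>
    paraboloid (r k) x)//; apply/funext.
exact: (@derivatives_continuous R flat_derivative 0 (@derivatives_flat R) 1).
Qed.

End cutoff.

(** * Perturbation *)

Section energy.
Context {R : realType}.
Variables (a alpha : R).
Hypothesis halpha : 1 <= alpha <= 2.

Lemma conjugate_exponent_ge2 : alpha != 1 -> 2 <= conjugate_exponent alpha.
Proof.
move: halpha => /andP[a1 a2] aN1.
have {a1}a1 : 1 < alpha by rewrite lt_def aN1.
have a0 : 0 < alpha by exact: lt_trans a1.
have i1 : alpha^-1 < 1 by rewrite invf_lt1.
rewrite /conjugate_exponent -[leLHS]invrK lef_pV2 ?posrE ?subr_gt0 ?invr_gt0//.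
have : 2^-1 <= alpha^-1 :> R by rewrite lef_pV2 ?posrE.
have : 2 * 2^-1 = 1 :> R by rewrite divff.
lra.
Qed.

Lemma H_ge0 x : (0 <= H a alpha x)%E.
Proof.
rewrite /H; case: ifP => _; first by rewrite lee_fin divr_ge0// sqr_ge0.
case: eqVneq => [//|/conjugate_exponent_ge2 b2]; rewrite lee_fin.
have b0 : 0 <= conjugate_exponent alpha by apply: le_trans b2.
apply: addr_ge0; first by rewrite mulr_ge0 ?divr_ge0 ?powR_ge0.
by rewrite mulr_ge0 ?sqr_ge0// divr_ge0 ?subr_ge0// mulr_ge0.
Qed.

Lemma measurable_H : measurable_fun setT (H a alpha).
Proof.
apply: measurable_fun_ifT.
- apply: measurable_fun_ler => //; exact: normr_measurable.
- apply/measurable_EFinP; apply: measurable_funM => //; exact: exprn_measurable.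
case: eqP => _; first exact: measurable_cst.
apply/measurable_EFinP; apply: measurable_funD => //.
apply: measurable_funM => //; apply: measurable_funM => //.
apply: (measurableT_comp (@measurable_powR R (conjugate_exponent alpha))).
exact: normr_measurable.
Qed.

Lemma H_ext_ge0 x : (0 <= H_ext a alpha x)%E.
Proof. by case: x => //= r; exact: H_ge0. Qed.

Lemma H_grad_ge0 n (f : 'rV[R]_n -> R) x : (0 <= H_grad a alpha f x)%E.
Proof. by apply: sume_ge0 => i _; exact: H_ext_ge0. Qed.

Lemma measurable_H_quot d (T : measurableType d) (u v : T -> R) :
  measurable_fun setT u -> measurable_fun setT v ->
  measurable_fun setT (fun x => H_ext a alpha (quot (u x) (v x))).
Proof.
move=> mu mv.
rewrite (_ : (fun _ => _) =
    (fun x => if v x == 0 then +oo%E else H a alpha (u x / v x))); last first.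
  by apply/funext => x; rewrite /quot; case: ifP.
apply: measurable_fun_ifT; first exact: measurable_fun_eqr.
  exact: measurable_cst.
apply: (measurableT_comp measurable_H); apply: measurable_funM => //.
exact: (measurableT_comp (@measurable_inv R)).
Qed.

Lemma measurable_smooth n (f : 'rV[R]_n -> R) : smooth f ->
  measurable_fun [set: Rn R n] f.
Proof. by move=> /smooth_continuous; exact: measurable_continuous. Qed.

Lemma measurable_partial n (f : 'rV[R]_n -> R) i : smooth f ->
  measurable_fun [set: Rn R n] (partial i f).
Proof. by move=> /(smooth_partial i); exact: measurable_smooth. Qed.

Lemma measurable_H_grad n (f : 'rV[R]_n -> R) : smooth f ->
  measurable_fun [set: Rn R n] (H_grad a alpha f).
Proof.
move=> sf; apply: emeasurable_sum => i.
by apply: measurable_H_quot;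
  [exact: measurable_partial|exact: measurable_smooth].
Qed.

Definition energy n (mu : probability (Rn R n) R) (f : 'rV[R]_n ->
  R) : \bar R :=
  (\int[mu]_x (H_grad a alpha f x * (f x ^+ 2)%:E))%E.

Lemma energy_density_ge0 n (f : 'rV[R]_n -> R) x :
  (0 <= H_grad a alpha f x * (f x ^+ 2)%:E)%E.
Proof. by rewrite mule_ge0 ?H_grad_ge0// lee_fin sqr_ge0. Qed.

Lemma measurable_energy_density n (f : 'rV[R]_n -> R) : smooth f ->
  measurable_fun [set: Rn R n] (fun x => H_grad a alpha f x * (f x ^+ 2)%:E)%E.
Proof.
move=> sf; apply: emeasurable_funM; first exact: measurable_H_grad.
by apply/measurable_EFinP/measurable_funX; exact: measurable_smooth.
Qed.

Lemma energy_ge0 n (mu : probability (Rn R n) R) f : (0 <= energy mu f)%E.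
Proof. by apply: integral_ge0 => x _; exact: energy_density_ge0. Qed.

Lemma EntE n (mu : probability (Rn R n) R) f : L2 mu f ->
  (Ent mu (fun x => f x ^+ 2)%R =
   \int[mu]_x (rel_ent (f x ^+ 2) (Rintegral mu setT (fun y =>
     f y ^+ 2)%R))%:E)%E.
Proof. by move=> f2; apply: integral_rel_ent => // x; exact: sqr_ge0. Qed.

Lemma integral_rel_ent_ge0 d (T : measurableType d) (mu : {measure set T ->
  \bar R})
    (g v : T -> R) : (forall x, 0 <= g x) -> (forall x, 0 <= v x) ->
  (0 <= \int[mu]_x (rel_ent (g x) (v x))%:E)%E.
Proof.
by move=> g0 v0; apply: integral_ge0 => x _; rewrite lee_fin rel_ent_ge0.
Qed.

Lemma Ent_ge0 n (mu : probability (Rn R n) R) f : L2 mu f ->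
  (0 <= Ent mu (fun x => f x ^+ 2)%R)%E.
Proof.
move=> f2; rewrite EntE//; apply: integral_rel_ent_ge0 => x;
  first exact: sqr_ge0.
by apply: Rintegral_ge0 => y _; exact: sqr_ge0.
Qed.

Lemma LSI_mono n (mu : probability (Rn R n) R) (C D : R) : C <= D ->
  LSI a alpha mu C -> LSI a alpha mu D.
Proof.
move=> CD lsi f sf f2; apply: (le_trans (lsi f sf f2)).
by apply: lee_wpmul2r; [exact: energy_ge0|rewrite lee_fin].
Qed.

Lemma LSI_neg n (mu : probability (Rn R n) R) (C : R) f : C < 0 ->
  LSI a alpha mu C -> smooth f -> L2 mu f -> energy mu f = 0%E.
Proof.
move=> C0 lsi sf f2; have := le_trans (Ent_ge0 f2) (lsi f sf f2).
rewrite -/(energy mu f); have := energy_ge0 mu f.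
rewrite le_eqVlt => /predU1P[<-//|E0].
by rewrite nmule_rge0 ?lte_fin// leNgt E0.
Qed.

Lemma LSI_perturbation n (mu nu : probability (Rn R n) R) (C c c' : R) :
  0 < c -> 0 < c' ->
  (forall A, measurable A -> nu A <= c%:E * mu A)%E ->
  (forall A, measurable A -> mu A <= c'%:E * nu A)%E ->
  LSI a alpha mu C -> LSI a alpha nu (C * (c * c')).
Proof.
move=> c0 c'0 numu munu lsi f sf fnu.
have nuint g : measurable_fun setT g -> (forall x, 0 <= g x)%E ->
    (\int[nu]_x g x <= c%:E * \int[mu]_x g x)%E.
  move=> mg g0; pose k := NngNum (ltW c0).
  rewrite -(ge0_integral_mscale mu measurableT k)//.
  by apply: ge0_le_measure_integral => // A mA; exact: numu.
have muint g : measurable_fun setT g -> (forall x, 0 <= g x)%E ->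
    (\int[mu]_x g x <= c'%:E * \int[nu]_x g x)%E.
  move=> mg g0; pose k := NngNum (ltW c'0).
  rewrite -(ge0_integral_mscale nu measurableT k)//.
  by apply: ge0_le_measure_integral => // A mA; exact: munu.
have mf := measurable_smooth sf.
have mf2 : measurable_fun setT (fun x : Rn R n => (f x ^+ 2)%:E).
  by apply/measurable_EFinP; exact: measurable_funX.
have f20 x : (0 <= (f x ^+ 2)%:E)%E by rewrite lee_fin sqr_ge0.
have fmu : L2 mu f.
  apply/integrableP; split => //; under eq_integral do rewrite gee0_abs//.
  apply: le_lt_trans (muint _ mf2 f20) _.
  have /integrableP[_] := fnu; under eq_integral do rewrite gee0_abs//.
  by move=> h; rewrite lte_mul_pinfty// lee_fin ltW.
set w := Rintegral mu setT (fun y => f y ^+ 2).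
have w0 : 0 <= w by apply: Rintegral_ge0 => x _; exact: sqr_ge0.
have wm : w = 0 -> Rintegral nu setT (fun y => f y ^+ 2) = 0.
  move=> wz; have := nuint _ mf2 f20.
  rewrite (integral_EFin_Rintegral fmu) (integral_EFin_Rintegral fnu) -/w wz
    mule0.
  rewrite lee_fin => h; apply/eqP; rewrite eq_le h.
  by apply: Rintegral_ge0 => x _; exact: sqr_ge0.
have mr : measurable_fun setT (fun x : Rn R n => (rel_ent (f x ^+ 2) w)%:E).
  apply/measurable_EFinP/measurable_rel_ent => //; exact: measurable_funX.
have r0 x : (0 <= (rel_ent (f x ^+ 2) w)%:E)%E by rewrite lee_fin rel_ent_ge0//
  sqr_ge0.
have step : (Ent nu (fun x => f x ^+ 2)%R <= c%:E * (C%:E * energy mu f))%E.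
  rewrite EntE//; apply: le_trans (rel_ent_min _ fnu w0 wm) _ => [x|].
    exact: sqr_ge0.
  apply: le_trans (nuint _ mr r0) _.
  rewrite lee_pmul2l// -EntE//; exact: lsi.
have dens0 := @energy_density_ge0 n f.
have mdens := measurable_energy_density sf.
have [C0|C0] := ltP C 0.
  have Emu := LSI_neg C0 lsi sf fmu.
  have Enu : energy nu f = 0%E.
    apply/eqP; rewrite eq_le energy_ge0 andbT.
    by apply: le_trans (nuint _ mdens dens0) _;
      rewrite -/(energy mu f) Emu mule0.
  by rewrite -/(energy nu f) Enu mule0; apply: le_trans step _;
    rewrite Emu !mule0.
apply: (le_trans step); rewrite -/(energy nu f).
have h : (energy mu f <= c'%:E * energy nu f)%E by exact: muint.
apply: (@le_trans _ _ (c%:E * (C%:E * (c'%:E * energy nu f)))%E).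
  apply: lee_wpmul2l; first by rewrite lee_fin ltW.
  by apply: lee_wpmul2l; first by rewrite lee_fin.
by rewrite !muleA -!EFinM mulrA (mulrC c).
Qed.

Lemma LSI_tilt n (mu : probability (Rn R n) R) (C : R) (h : Rn R n -> R)
    (mh : measurable_fun setT h) (bh : bounded_fun h) :
  LSI a alpha mu C -> LSI a alpha (tilt mu mh bh) (C * expR (osc h)).
Proof.
move=> lsi; set Z := Rintegral mu setT (fun y => expR (h y)).
have [M [_ hM]] := bh.
have {}hM x : `|h x| <= M + 1 by apply: (hM (M + 1)) => //; rewrite ltrDl.
have hsup x : h x <= sup (range h).
  apply: sup_upper_bound; last by exists x.
  split; first by exists (h 0), 0.
  by exists (M + 1) => _ [y _ <-]; exact: le_trans (ler_norm _) (hM y).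
have hinf x : inf (range h) <= h x.
  apply: ge_inf; last by exists x.
  exists (- (M + 1)) => _ [y _ <-].
  by have := hM y; rewrite ler_norml => /andP[].
have mE : measurable_fun setT (fun x => expR (h x)) by exact: measurableT_comp.
have ei : mu.-integrable setT (EFin \o (fun x => expR (h x))).
  apply: (@le_integrable _ _ _ _ _ _ _ (EFin \o cst (expR (M + 1)))) => //.
  - exact/measurable_EFinP.
  - move=> x _; rewrite lee_fin !ger0_norm ?expR_ge0// ler_expR.
    exact: le_trans (ler_norm _) (hM x).
  - exact: integrable_cst.
have Z0 : 0 < Z.
  rewrite -lte_fin -(integral_EFin_Rintegral ei).
  apply: (@lt_le_trans _ _ (expR (- (M + 1)))%:E);
    first by rewrite lte_fin expR_gt0.
  rewrite -(integral_cst1 mu); apply: ge0_le_integral => //.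
  - exact/measurable_EFinP.
  - by move=> x _; rewrite lee_fin ler_expR; have := hM x;
    rewrite ler_norml => /andP[].
pose c := expR (sup (range h)) / Z; pose c' := Z * expR (- inf (range h)).
have c0 : 0 < c by rewrite divr_gt0 ?expR_gt0.
have c'0 : 0 < c' by rewrite mulr_gt0 ?expR_gt0.
have -> : expR (osc h) = c * c'.
  by rewrite /c /c' mulrA divfK ?gt_eqF// -expRD.
have mdens : measurable_fun setT (fun x => (expR (h x) / Z)%:E).
  by apply/measurable_EFinP; exact: measurable_funM.
have dens0 x : (0 <= (expR (h x) / Z)%:E)%E.
  by rewrite lee_fin divr_ge0 ?expR_ge0// ltW.
apply: LSI_perturbation lsi => // A mA.
- rewrite [leLHS]/(tilt _ _ _ _) -/Z -integral_cst//.
  apply: ge0_le_integral => //.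
  + exact: measurable_funTS.
  + by move=> x _; rewrite lee_fin ler_pM2r ?invr_gt0// ler_expR.
- have -> : (mu A = c'%:E * ((c'^-1)%:E * mu A))%E.
    by rewrite muleA -EFinM mulfV ?gt_eqF// mul1e.
  apply: lee_wpmul2l; first by rewrite lee_fin ltW.
  rewrite [leRHS]/(tilt _ _ _ _) -/Z -integral_cst//.
  apply: ge0_le_integral => //.
  + by move=> x _; rewrite lee_fin invr_ge0 ltW.
  + exact: measurable_funTS.
  + move=> x _; rewrite lee_fin /c' invfM -expRN opprK mulrC.
    by rewrite ler_pM2r ?invr_gt0// ler_expR.
Qed.

End energy.

(** * Tensorisation *)

Section slice.
Context {R : realType} {m n : nat}.
Variables (iota : 'rV[R]_m -> 'rV[R]_n) (s : 'I_m -> 'I_n).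
Hypothesis ciota : continuous iota.
Hypothesis iotaE : forall (t : R) i x,
  iota (t *: delta_mx 0 i + x) = t *: delta_mx 0 (s i) + iota x.

Let is_derive_slice (f : 'rV[R]_n -> R) i x : smooth f ->
  is_derive x (delta_mx 0 i) (f \o iota) (partial (s i) f (iota x)).
Proof.
move=> /(smooth_is_derive (s i) (iota x))/is_derive_line df.
apply/is_derive_line; rewrite (_ : (fun t => _) = (fun t =>
  f (t *: delta_mx 0 (s i) + iota x)))//.
by apply/funext => t /=; rewrite iotaE.
Qed.

Lemma partial_slice (f : 'rV[R]_n -> R) i : smooth f ->
  partial i (f \o iota) = partial (s i) f \o iota.
Proof.
by move=> sf; apply/funext => x; have [_] := is_derive_slice i x sf.
Qed.

Lemma smooth_slice (f : 'rV[R]_n -> R) : smooth f -> smooth (f \o iota).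
Proof.
move=> sf; apply: (@smooth_stable _ _ (fun g =>
  exists2 f, smooth f & g = f \o iota)).
- move=> _ [{}f {}sf ->] x; apply: continuous_comp; first exact: ciota.
  exact: smooth_continuous.
- by move=> _ i x [{}f {}sf ->]; have [] := is_derive_slice i x sf.
- move=> _ i [{}f {}sf ->]; exists (partial (s i) f);
  first exact: smooth_partial.
  exact: partial_slice.
- by exists f.
Qed.

End slice.

Section row_mx_slices.
Context {R : realType} {n1 n2 : nat}.

Lemma continuous_row_mxl (y : 'rV[R]_n2) :
  continuous (fun x : 'rV[R]_n1 => row_mx x y).
Proof.
move=> x A /nbhs_ballP[e e0 eA]; apply/nbhs_ballP; exists e => // z xz.
apply: eA; split=> // i j; case: (split_ordP j) => k ->.
  by rewrite !row_mxEl; exact: xz.2.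
by rewrite !row_mxEr; exact: ballxx.
Qed.

Lemma continuous_row_mxr (x : 'rV[R]_n1) :
  continuous (fun y : 'rV[R]_n2 => row_mx x y).
Proof.
move=> y A /nbhs_ballP[e e0 eA]; apply/nbhs_ballP; exists e => // z yz.
apply: eA; split=> // i j; case: (split_ordP j) => k ->.
  by rewrite !row_mxEl; exact: ballxx.
by rewrite !row_mxEr; exact: yz.2.
Qed.

Let row_mxlE (y : 'rV[R]_n2) (t : R) i (x : 'rV[R]_n1) :
  row_mx (t *: delta_mx 0 i + x) y = t *: delta_mx 0 (lshift n2 i) + row_mx x y.
Proof.
apply/rowP => j; rewrite [RHS]mxE [X in _ = X + _]mxE [X in _ = _ * X + _]mxE.
case: (split_ordP j) => k ->.
  by rewrite !row_mxEl !mxE (inj_eq (@lshift_inj _ _)).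
by rewrite !row_mxEr eq_rlshift andbF mulr0 add0r.
Qed.

Let row_mxrE (x : 'rV[R]_n1) (t : R) i (y : 'rV[R]_n2) :
  row_mx x (t *: delta_mx 0 i + y) = t *: delta_mx 0 (rshift n1 i) + row_mx x y.
Proof.
apply/rowP => j; rewrite [RHS]mxE [X in _ = X + _]mxE [X in _ = _ * X + _]mxE.
case: (split_ordP j) => k ->.
  by rewrite !row_mxEl eq_lrshift andbF mulr0 add0r.
by rewrite !row_mxEr !mxE (inj_eq (@rshift_inj _ _)).
Qed.

Variable f : 'rV[R]_(n1 + n2) -> R.
Hypothesis sf : smooth f.

Lemma smooth_row_mxl y : smooth (fun x : 'rV[R]_n1 => f (row_mx x y)).
Proof. exact: (smooth_slice (@continuous_row_mxl y) (row_mxlE y) sf). Qed.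

Lemma smooth_row_mxr x : smooth (fun y : 'rV[R]_n2 => f (row_mx x y)).
Proof. exact: (smooth_slice (@continuous_row_mxr x) (row_mxrE x) sf). Qed.

Lemma H_grad_row_mxl a alpha x y :
  H_grad a alpha (fun x : 'rV[R]_n1 => f (row_mx x y)) x =
  (\sum_(i < n1) H_ext a alpha
     (quot (partial (lshift n2 i) f (row_mx x y)) (f (row_mx x y))))%E.
Proof.
by apply: eq_bigr => i _; rewrite [partial i _](partial_slice (row_mxlE y) i
  sf).
Qed.

Lemma H_grad_row_mxr a alpha x y :
  H_grad a alpha (fun y : 'rV[R]_n2 => f (row_mx x y)) y =
  (\sum_(i < n2) H_ext a alpha
     (quot (partial (rshift n1 i) f (row_mx x y)) (f (row_mx x y))))%E.
Proof.
by apply: eq_bigr => i _; rewrite [partial i _](partial_slice (row_mxrE x) i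
  sf).
Qed.

Lemma H_grad_row_mx a alpha x y :
  (H_grad a alpha f (row_mx x y) =
   H_grad a alpha (fun x => f (row_mx x y)) x +
   H_grad a alpha (fun y => f (row_mx x y)) y)%E.
Proof. by rewrite H_grad_row_mxl H_grad_row_mxr /H_grad big_split_ord. Qed.

End row_mx_slices.

Section tensorisation.
Context {R : realType}.
Variables (a alpha : R).
Hypothesis halpha : 1 <= alpha <= 2.

Lemma LSI_product n1 n2 (mu1 : probability (Rn R n1) R)
    (mu2 : probability (Rn R n2) R) (C1 C2 : R) :
  LSI a alpha mu1 C1 -> LSI a alpha mu2 C2 ->
  LSI a alpha (prod_prob mu1 mu2) (Num.max C1 C2).
Proof.
move=> lsi1 lsi2 f sf f2; set D := Num.max C1 C2.
have {}lsi1 := LSI_mono halpha (_ : C1 <= D) lsi1.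
have {}lsi2 := LSI_mono halpha (_ : C2 <= D) lsi2.
have {lsi1} lsi1 : LSI a alpha mu1 D by apply: lsi1; rewrite le_max lexx.
have {lsi2} lsi2 : LSI a alpha mu2 D by apply: lsi2; rewrite le_max lexx orbT.
rewrite -/(energy a alpha (prod_prob mu1 mu2) f) EntE//.
have mf := measurable_smooth sf.
pose g (p : Rn R n1 * Rn R n2) := f (row_mx p.1 p.2) ^+ 2.
have g0 p : 0 <= g p by exact: sqr_ge0.
have mf2 : measurable_fun setT (fun x : Rn R (n1 + n2) =>
  f x ^+ 2) by exact: measurable_funX.
have mg : measurable_fun setT g by exact:
  (measurableT_comp mf2 measurable_concat).
have intE (h : Rn R (n1 + n2) -> \bar R) : measurable_fun setT h ->
  (forall x, 0 <= h x)%E ->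
    (\int[prod_prob mu1 mu2]_x h x = \int[mu1 \x mu2]_p h (row_mx p.1 p.2))%E.
  by move=> mh h0; rewrite ge0_integral_distribution.
have gi : (mu1 \x mu2)%E.-integrable setT (EFin \o g).
  apply/integrableP; split; first exact/measurable_EFinP.
  have /integrableP[_] := f2.
  under eq_integral do rewrite gee0_abs ?lee_fin ?sqr_ge0//.
  rewrite intE//; last 2 first.
  - exact/measurable_EFinP.
  - by move=> x; rewrite lee_fin sqr_ge0.
  by under [in X in _ -> X]eq_integral do rewrite /= ger0_norm//.
have mE : Rintegral (prod_prob mu1 mu2) setT (fun y => f y ^+ 2) =
    Rintegral (mu1 \x mu2)%E setT g.
  rewrite /Rintegral intE//; first exact/measurable_EFinP.
  by move=> x; rewrite lee_fin sqr_ge0.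
rewrite mE; set m := Rintegral _ _ g.
have m0 : 0 <= m by apply: Rintegral_ge0 => p _; exact: g0.
rewrite intE; last 2 first.
- apply/measurable_EFinP; exact: measurable_rel_ent.
- by move=> x; rewrite lee_fin rel_ent_ge0// sqr_ge0.
pose K1 (p : Rn R n1 * Rn R n2) :=
  (H_grad a alpha (fun x : 'rV_n1 => f (row_mx x p.2)) p.1 * (g p)%:E)%E.
pose K2 (p : Rn R n1 * Rn R n2) :=
  (H_grad a alpha (fun y : 'rV_n2 => f (row_mx p.1 y)) p.2 * (g p)%:E)%E.
have K10 p : (0 <= K1 p)%E by rewrite mule_ge0 ?H_grad_ge0// lee_fin.
have K20 p : (0 <= K2 p)%E by rewrite mule_ge0 ?H_grad_ge0// lee_fin.
have mgE : measurable_fun setT (EFin \o g) by exact/measurable_EFinP.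
have mK1 : measurable_fun setT K1.
  apply: emeasurable_funM => //; under eq_fun do rewrite H_grad_row_mxl//.
  apply: emeasurable_sum => i; apply: measurable_H_quot => //.
    exact: (measurableT_comp (measurable_partial _ sf) measurable_concat).
  exact: (measurableT_comp mf measurable_concat).
have mK2 : measurable_fun setT K2.
  apply: emeasurable_funM => //; under eq_fun do rewrite H_grad_row_mxr//.
  apply: emeasurable_sum => i; apply: measurable_H_quot => //.
    exact: (measurableT_comp (measurable_partial _ sf) measurable_concat).
  exact: (measurableT_comp mf measurable_concat).
have EK : energy a alpha (prod_prob mu1 mu2) f = (\int[mu1 \x mu2]_p (K1 p + K2
  p))%E.
  rewrite /energy intE; last 2 first.
  - exact: measurable_energy_density.
  - exact: energy_density_ge0.
  apply: eq_integral => p _; rewrite H_grad_row_mx// ge0_muleDl//;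
    exact: H_grad_ge0.
have tensor (E : R) : 0 <= E -> D <= E ->
    (\int[mu1 \x mu2]_p (rel_ent (g p) m)%:E <=
     E%:E * \int[mu1 \x mu2]_p (K1 p + K2 p))%E.
  move=> E0 DE; apply: rel_ent_tensor_le => //.
  - have := ae_integrable2 gi; apply: filterS => y fy.
    have sfy := smooth_row_mxl sf y.
    by have := LSI_mono halpha DE lsi1 sfy fy; rewrite EntE.
  - have := ae_integrable1 gi; apply: filterS => x fx.
    have sfx := smooth_row_mxr sf x.
    by have := LSI_mono halpha DE lsi2 sfx fx; rewrite EntE.
rewrite EK; have [D0|D0] := ltP D 0; last exact: tensor.
suff -> : (\int[mu1 \x mu2]_p (K1 p + K2 p) = 0)%E.
  by rewrite mule0; have := tensor 0 (lexx _) (ltW D0); rewrite mul0e.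
rewrite ge0_integralD// (fubini_tonelli2 K1)// (fubini_tonelli1 K2)//.
rewrite (_ : \int[mu2]_y _ = \int[mu2]_y cst 0 y)%E; last first.
  apply: ae_eq_integral => //.
    exact: (measurable_fun_fubini_tonelli_G (m1 := mu1) K1 mK1 K10).
  have := ae_integrable2 gi; apply: filterS => y fy _.
  exact: (LSI_neg halpha D0 lsi1 (smooth_row_mxl sf y) fy).
rewrite (_ : \int[mu1]_x _ = \int[mu1]_x cst 0 x)%E; last first.
  apply: ae_eq_integral => //.
    exact: (measurable_fun_fubini_tonelli_F (m2 := mu2) K2 mK2 K20).
  have := ae_integrable1 gi; apply: filterS => x fx _.
  exact: (LSI_neg halpha D0 lsi2 (smooth_row_mxr sf x) fx).
by rewrite !integral0 adde0.
Qed.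

End tensorisation.

(** * Poincare inequality *)

Section bounded_poincare.
Context {R : realType} {n : nat}.
Variables (a alpha : R).
Hypothesis a0 : 0 < a.
Variables (mu : probability (Rn R n) R) (C : R).
Hypothesis lsi : LSI a alpha mu C.
Implicit Types f g : 'rV[R]_n -> R.

Definition sqr_grad f (x : 'rV[R]_n) : R := \sum_(i < n) partial i f x ^+ 2.

Lemma sqr_grad_ge0 f x : 0 <= sqr_grad f x.
Proof. by apply: sumr_ge0 => i _; exact: sqr_ge0. Qed.

Lemma measurable_sqr_grad f : smooth f ->
  measurable_fun [set: Rn R n] (sqr_grad f).
Proof.
move=> sf; apply: measurable_sum => i; apply: measurable_funX.
exact: measurable_partial.
Qed.

Lemma bounded_L2 f (M : R) : measurable_fun [set: Rn R n] f ->
  (forall x, `|f x| <= M) -> L2 mu f.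
Proof.
move=> mf fM; apply: (@le_integrable _ _ _ _ _ _ _ (EFin \o cst (M ^+ 2))) =>
  //.
- by apply/measurable_EFinP; exact: measurable_funX.
- move=> x _; have M0 := le_trans (normr_ge0 (f x)) (fM x).
  by rewrite lee_fin/= !normrX lerXn2r ?nnegrE// (ger0_norm M0).
- exact: integrable_cst.
Qed.

Lemma poincare_bounded g (M : R) : smooth g ->
  (forall x, `|g x| <= M) -> (forall i x, `|partial i g x| <= M) ->
  (sqr_variance mu g <= (C / 2)%:E * \int[mu]_x (sqr_grad g x)%:E)%E.
Proof.
move=> sg; wlog M0 : M / 0 < M => [wM gM dgM|].
  apply: (wM (`|M| + 1)); first by rewrite ltr_wpDl.
  - by move=> x; apply: le_trans (gM x) _; have := ler_norm M; lra.
  - by move=> i x; apply: le_trans (dgM i x) _; have := ler_norm M; lra.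
move=> gM dgM.
have mg := measurable_smooth sg.
have g2 : L2 mu g by exact: bounded_L2 gM.
pose e := Num.min 1 a / (2 * M).
have e0 : 0 < e by rewrite divr_gt0 ?lt_min ?ltr01 ?a0 ?mulr_gt0.
have eM : e * M = Num.min 1 a / 2.
  by rewrite /e; field; rewrite gt_eqF.
have min1 : Num.min 1 a <= 1 by rewrite ge_min lexx.
have mina : Num.min 1 a <= a by rewrite ge_min lexx orbT.
pose f := cst 1 \+ cst e \* g.
have seg : smooth (cst e \* g) by apply: smoothM; [exact: smooth_cst|exact: sg].
have sf : smooth f by apply: smoothD; [exact: smooth_cst|exact: seg].
have df i x : partial i f x = e * partial i g x.
  rewrite partialD; [|exact: smooth_cst|exact: seg].
  rewrite partialM; [|exact: smooth_cst|exact: sg].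
  by rewrite !partial_cst mulr0 addr0 add0r.
have egM x : `|e * g x| <= 2^-1.
  rewrite normrM (gtr0_norm e0); have := ler_wpM2l (ltW e0) (gM x);
    rewrite eM; lra.
have f12 x : 2^-1 <= f x.
  by have := egM x; rewrite ler_norml /f/= => /andP[]; lra.
have f0 x : 0 < f x by apply: lt_le_trans (f12 x); rewrite invr_gt0.
have f1 x : `|f x| <= 2.
  by rewrite gtr0_norm//; have := egM x; rewrite ler_norml /f/= => /andP[]; lra.
have mf := measurable_smooth sf.
have f2 : L2 mu f by exact: bounded_L2 f1.
have HE x : (H_grad a alpha f x * (f x ^+ 2)%:E = (e ^+ 2 / 2 * sqr_grad g
  x)%:E)%E.
  rewrite /H_grad (eq_bigr (fun i =>
    ((e * partial i g x / f x) ^+ 2 / 2)%:E)); last first.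
    move=> i _; rewrite /quot gt_eqF// df /= /H ifT// normrM normfV (gtr0_norm
      (f0 x)).
    rewrite ler_pdivrMr// normrM (gtr0_norm e0).
    apply: (@le_trans _ _ (e * M)); first by rewrite ler_wpM2l// ltW.
    rewrite eM; have := ler_wpM2l (ltW a0) (f12 x); lra.
  rewrite sumEFin -EFinM mulr_suml mulr_sumr; congr (_%:E).
  apply: eq_bigr => i _; field; exact: lt0r_neq0.
have Ef : Rintegral mu setT f = 1 + e * Rintegral mu setT g.
  have gi := sqr_integrable mg g2.
  rewrite RintegralD//=; last 2 first.
  - exact: (integrable_cst mu 1).
  - by rewrite (_ : _ \o _ = fun x => e%:E * (g x)%:E)%E//; exact: integrableZl.
  by rewrite RintegralZl// Rintegral_cst1.
have vE : (sqr_variance mu f = (e ^+ 2)%:E * sqr_variance mu g)%E.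
  rewrite (variance_centered mf f2) (variance_centered mg g2) Ef.
  rewrite -ge0_integralZl//; last 3 first.
  - by apply/measurable_EFinP/measurable_funX/measurable_funB.
  - by move=> x _; rewrite lee_fin sqr_ge0.
  - by rewrite lee_fin sqr_ge0.
  by apply: eq_integral => x _; rewrite -EFinM; congr (_%:E); rewrite /f/=;
    ring.
have e20 : 0 < e ^+ 2 by rewrite exprn_gt0.
rewrite -(@lee_pmul2l _ (e ^+ 2)%:E)// -vE.
apply: le_trans (variance_le_entropy mf f0 f2) _.
apply: le_trans (lsi sf f2) _.
under eq_integral do rewrite HE EFinM.
rewrite ge0_integralZl//; last 3 first.
- by apply/measurable_EFinP; exact: measurable_sqr_grad.
- by move=> x _; rewrite lee_fin sqr_grad_ge0.
- by rewrite lee_fin divr_ge0 ?ltW.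
rewrite !muleA -!EFinM le_eqVlt (_ :
  C * (e ^+ 2 / 2) = e ^+ 2 * (C / 2)) ?eqxx//.
ring.
Qed.

End bounded_poincare.

Lemma sin_scaled_cvg (R : realType) (y : R) :
  k.+1%:R * sin (k.+1%:R^-1 * y) @[k --> \oo] --> y.
Proof.
have /is_derive1_caratheodory[g [gE cg g0]] := is_derive_sin (0 : R).
have E k : k.+1%:R * sin (k.+1%:R^-1 * y) = g (k.+1%:R^-1 * y) * y.
  have := gE (k.+1%:R^-1 * y); rewrite sin0 !subr0 => ->.
  by rewrite mulrCA mulVKf ?pnatr_eq0.
rewrite (_ : (fun k => _) = fun k => g (k.+1%:R^-1 * y) * y); last exact/funext.
have h : k.+1%:R^-1 * y @[k --> \oo] --> (0 : R).
  rewrite -[X in _ --> X](mul0r y).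
  by apply: cvgM; [exact: cvg_harmonic|exact: cvg_cst].
have : g (k.+1%:R^-1 * y) * y @[k --> \oo] --> g 0 * y.
  by apply: cvgM; [exact: (cvg_comp _ _ h cg)|exact: cvg_cst].
by rewrite g0 cos0 mul1r.
Qed.

Section nonnegative_constant.
Context {R : realType} {n : nat}.
Variables (a alpha : R).
Hypothesis a0 : 0 < a.
Variables (mu : probability (Rn R n) R) (C : R).
Hypothesis lsi : LSI a alpha mu C.
Implicit Types f g : 'rV[R]_n -> R.

Let poincare g M := poincare_bounded a0 lsi (g := g) (M := M).

Lemma sqr_grad_coord D (i : 'I_n) x : derivatives D ->
  sqr_grad (D 0 \o (fun y : 'rV[R]_n => y 0 i)) x = D 1 (x 0 i) ^+ 2.
Proof.
move=> dD; rewrite /sqr_grad (bigD1 i)//= big1 ?addr0 => [|j ji];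
  (rewrite partial_comp; [|exact: dD|exact: smooth_coord]);
    rewrite partial_coord.
  by rewrite eqxx mulr1.
by rewrite (negbTE ji) mulr0 expr0n.
Qed.

Lemma sqr_variance_ge0 f : smooth f -> L2 mu f -> (0 <= sqr_variance mu f)%E.
Proof.
move=> sf f2; rewrite (variance_centered (measurable_smooth sf) f2).
by apply: integral_ge0 => x _; rewrite lee_fin sqr_ge0.
Qed.

(* Testing against [sin x_i] and [cos x_i], whose [sqr_grad]s add up to 1. *)
Lemma LSI_ge0 (i : 'I_n) : 0 <= C.
Proof.
rewrite leNgt; apply/negP => C0.
have sqr_grad0 D : derivatives D -> (forall k t, `|D k t| <= 1) ->
    (\int[mu]_x (D 1 (x 0 i) ^+ 2)%:E <= 0)%E.
  move=> dD D1; set g := D 0 \o (fun y : 'rV[R]_n => y 0 i).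
  have sg : smooth g by apply: smooth_comp => //; exact: smooth_coord.
  have g1 x : `|g x| <= 1 by exact: D1.
  have dg1 j x : `|partial j g x| <= 1.
    rewrite partial_comp; [|exact: dD|exact: smooth_coord].
    rewrite partial_coord normrM; case: eqP => _ /=.
      by rewrite normr1 mulr1; exact: D1.
    by rewrite normr0 mulr0.
  have := le_trans (sqr_variance_ge0 sg (bounded_L2 mu (measurable_smooth sg)
    g1)) (poincare sg g1 dg1).
  rewrite nmule_rge0 ?lte_fin ?pmulr_llt0//.
  by under eq_integral do rewrite sqr_grad_coord//.
pose D' k := @sin_derivative R k.+1.
have d' : derivatives D' by move=> k; exact: derivatives_sin.
have := leeD (sqr_grad0 _ (@derivatives_sin R) norm_sin_derivative)
  (sqr_grad0 D' d' (fun k => norm_sin_derivative k.+1)).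
have mcoord : measurable_fun [set: Rn R n] (fun x : 'rV[R]_n => x 0 i).
  exact: measurable_smooth (smooth_coord i).
have mD D k : derivatives D ->
  measurable_fun [set: Rn R n] (fun x : 'rV[R]_n => (D k (x 0 i) ^+ 2)%:E).
  move=> dD; apply/measurable_EFinP/measurable_funX.
  apply: (measurableT_comp _ mcoord); apply: continuous_measurable_fun.
  exact: derivatives_continuous.
rewrite -ge0_integralD//; last 4 first.
- by move=> x _; rewrite lee_fin sqr_ge0.
- exact: mD (@derivatives_sin R).
- by move=> x _; rewrite lee_fin sqr_ge0.
- exact: mD d'.
under eq_integral do rewrite /D' !sin_derivativeS mulr1n cosDpihalf mulr0n
  addr0 sqrrN -EFinD cos2Dsin2.
by rewrite integral_cst1 adde0 lee_fin ler10.
Qed.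

End nonnegative_constant.

Lemma partial_bounded_box (R : realType) n (f : 'rV[R]_n ->
  R) (i : 'I_n) (B : R) :
  smooth f -> exists M, forall x : 'rV[R]_n,
    (forall j, `|x 0 j| <= B) -> `|partial i f x| <= M.
Proof.
move=> sf.
have cA : compact [set x : 'rV[R]_n | forall j, `[- B, B]%classic (x ord0 j)].
  have := @rV_compact R n (fun=> `[- B,
    B]%classic) (fun=> @segment_compact _ _ _).
exact.
have cf : continuous (partial i f) by exact/smooth_continuous/smooth_partial.
have /compact_bounded [M [_ bM]] :=
  continuous_compact (continuous_subspaceT cf) cA.
exists (M + 1) => x xB.
have M1 : M < M + 1 by rewrite ltrDl.
apply: (bM _ M1); exists x => // j; rewrite /= in_itv/=.
by have := xB j; rewrite ler_norml.
Qed.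

Section truncation.
Context {R : realType} {n : nat}.
Variable f : 'rV[R]_n -> R.
Hypothesis sf : smooth f.

Let s (k : nat) : R := k.+1%:R^-1.
Let s0 k : 0 < s k. Proof. by rewrite invr_gt0. Qed.
Let s1 k : s k <= 1. Proof. by rewrite invf_le1// ler1n. Qed.
Let sK k : k.+1%:R * s k = 1. Proof. by rewrite mulfV ?pnatr_eq0. Qed.

Let sine k : 'rV[R]_n -> R :=
  cst k.+1%:R \* (sin_derivative 0 \o (cst (s k) \* f)).

(* The cutoff radius [(k+1)^2] beats the bound [k+1] of the sine, so that the
   gradient of the cutoff contributes [O(1/k)]. *)
Definition truncation k : 'rV[R]_n -> R := cutoff (s k ^+ 2) \* sine k.

Let smooth_scaled k : smooth (cst (s k) \* f).
Proof. by apply: smoothM; [exact: smooth_cst|exact: sf]. Qed.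

Let smooth_sin k : smooth (sin_derivative 0 \o (cst (s k) \* f)).
Proof. by apply: smooth_comp;
  [exact: derivatives_sin|exact: smooth_scaled]. Qed.

Let smooth_sine k : smooth (sine k).
Proof. by apply: smoothM; [exact: smooth_cst|exact: smooth_sin]. Qed.

Lemma smooth_truncation k : smooth (truncation k).
Proof. by apply: smoothM; [exact: smooth_cutoff|exact: smooth_sine]. Qed.

Let norm_sine k x : `|sine k x| <= k.+1%:R.
Proof. by rewrite normrM ger0_norm// ler_piMr//;
  exact: norm_sin_derivative. Qed.

Let partial_sine k i x :
  partial i (sine k) x = sin_derivative 1 (s k * f x) * partial i f x.
Proof.
rewrite partialM; [|exact: smooth_cst|exact: smooth_sin].
rewrite partial_comp; [|exact: derivatives_sin|exact: smooth_scaled].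
rewrite partialM; [|exact: smooth_cst|exact: sf].
rewrite !partial_cst !mulr0 !addr0 /= mulrCA; congr (_ * _).
by rewrite mulrA sK mul1r.
Qed.

Let partial_truncation k i x : partial i (truncation k) x =
  cutoff (s k ^+ 2) x * sin_derivative 1 (s k * f x) * partial i f x +
  sine k x * partial i (cutoff (s k ^+ 2)) x.
Proof.
rewrite partialM; [|exact: smooth_cutoff|exact: smooth_sine].
by rewrite partial_sine mulrA.
Qed.

Lemma norm_truncation k x : `|truncation k x| <= k.+1%:R.
Proof.
rewrite normrM; apply: le_trans (norm_sine k x).
by rewrite ler_piMl//; exact: norm_cutoff.
Qed.

Lemma truncation_cvg x : truncation k x @[k --> \oo] --> f x.
Proof.
rewrite -[X in _ --> X]mul1r; apply: cvgM.
  apply: cutoff_cvg; rewrite -[X in _ --> X](mulr0 0).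
  under eq_fun do rewrite expr2.
  by apply: cvgM; exact: cvg_harmonic.
rewrite (_ : (fun k => _) = fun k => k.+1%:R * sin (k.+1%:R^-1 * f x)).
  exact: sin_scaled_cvg.
by apply/funext => k; rewrite /sine/= /sin_derivative mulr0n addr0.
Qed.

Let vbound : exists2 K, 0 <= K & forall k i x,
  `|sine k x * partial i (cutoff (s k ^+ 2)) x| <= K * s k.
Proof.
have [K bK] := @partial_cutoff_le R n.
exists `|K| => // k i x; rewrite normrM.
apply: (@le_trans _ _ (k.+1%:R * (`|K| * `|s k ^+ 2|))).
  apply: ler_pM => //; apply: le_trans (bK _ _ _) _.
  by rewrite ler_wpM2r// ler_norm.
by rewrite (ger0_norm (sqr_ge0 _)) mulrCA expr2 (mulrA k.+1%:R) sK mul1r.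
Qed.

Lemma partial_truncation_bounded k :
  exists M, forall i x, `|partial i (truncation k) x| <= M.
Proof.
have [K K0 vK] := vbound.
have /choice[M bM] i := partial_bounded_box i (s k ^- 2) sf.
exists (\sum_(i < n) `|M i| + K * s k) => i x.
rewrite partial_truncation; apply: le_trans (ler_normD _ _) _.
apply: lerD => //; apply: (@le_trans _ _ `|M i|); last first.
  by rewrite (bigD1 i)//= lerDl sumr_ge0.
have [q0|q0] := leP (paraboloid (s k ^+ 2) x) 0.
  by rewrite cutoff_eq0// !mul0r normr0.
rewrite 2!normrM; apply: (@le_trans _ _ `|partial i f x|).
  rewrite ler_piMl// mulr_ile1//;
    [exact: norm_cutoff|exact: norm_sin_derivative].
apply: le_trans (ler_norm _); apply: bM => j.
have := paraboloid_gt0 j q0.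
by rewrite normrM ger0_norm ?sqr_ge0// mulrC -ler_pdivlMr ?exprn_gt0// mul1r.
Qed.

Lemma sqr_grad_truncation_le : exists2 B, 0 <= B & forall k x,
  sqr_grad (truncation k) x <= (1 + s k) * sqr_grad f x + s k * B.
Proof.
have [K K0 vK] := vbound; exists (2 * K ^+ 2 *+ n) => [|k x].
  by rewrite mulrn_wge0// mulr_ge0 ?sqr_ge0.
have -> : 2 * K ^+ 2 *+ n = \sum_(i < n) 2 * K ^+ 2 by rewrite sumr_const
  card_ord.
rewrite /sqr_grad !mulr_sumr -big_split/=.
apply: ler_sum => i _; rewrite partial_truncation.
set u := _ * partial i f x; set v := sine k x * _.
have uf : u ^+ 2 <= partial i f x ^+ 2.
  rewrite /u exprMn ler_piMl ?sqr_ge0// -[leRHS](expr1n _ 2).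
  rewrite -(@real_normK _ (_ * _))// ?num_real// lerXn2r ?nnegrE// normrM.
  by rewrite mulr_ile1//; [exact: norm_cutoff|exact: norm_sin_derivative].
have vs : v ^+ 2 <= K ^+ 2 * s k ^+ 2.
  rewrite -exprMn -(@real_normK _ v) ?num_real// lerXn2r ?nnegrE// ?mulr_ge0
    ?(ltW (s0 k))//.
  exact: vK.
have young : 2 * u * v <= s k * u ^+ 2 + (s k)^-1 * v ^+ 2.
  rewrite -subr_ge0 (_ : _ - _ = s k * (u - v / s k) ^+ 2).
    by rewrite mulr_ge0 ?sqr_ge0// ltW.
  by field; rewrite gt_eqF.
have v1 : (s k)^-1 * v ^+ 2 <= K ^+ 2 * s k.
  rewrite mulrC ler_pdivrMr//; apply: le_trans vs _.
  by have -> : K ^+ 2 * s k * s k = K ^+ 2 * s k ^+ 2 by ring.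
have v2 : v ^+ 2 <= K ^+ 2 * s k.
  apply: (le_trans vs); rewrite ler_wpM2l ?sqr_ge0// expr2 ler_piMl//.
  exact: ltW.
have u1 : s k * u ^+ 2 <= s k * partial i f x ^+ 2 by rewrite ler_wpM2l// ltW.
have -> : (u + v) ^+ 2 = u ^+ 2 + 2 * u * v + v ^+ 2 by ring.
lra.
Qed.

End truncation.

Section poincare.
Context {R : realType} {n : nat}.
Variables (a alpha : R).
Hypothesis a0 : 0 < a.
Variables (mu : probability (Rn R n) R) (C : R).
Hypothesis lsi : LSI a alpha mu C.
Variable f : 'rV[R]_n -> R.
Hypothesis sf : smooth f.

Lemma LSI_poincare :
  (sqr_variance mu f <= (C / 2)%:E * \int[mu]_x (sqr_grad f x)%:E)%E.
Proof.
have [n0|n0] := posnP n.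
  have fE x : f x = f 0.
    by congr f; apply/rowP => i; have := ltn_ord i; rewrite {2}n0 ltn0.
  apply: (poincare_bounded a0 lsi sf (M := `|f 0|)) => [x|i];
    first by rewrite fE.
  by have := ltn_ord i; rewrite {2}n0 ltn0.
have C0 : 0 <= C := LSI_ge0 a0 lsi (Ordinal n0).
have mf := measurable_smooth sf.
have mgf : measurable_fun [set: Rn R n] (fun x => (sqr_grad f x)%:E).
  by apply/measurable_EFinP; exact: measurable_sqr_grad.
have gf0 x : (0 <= (sqr_grad f x)%:E)%E by rewrite lee_fin sqr_grad_ge0.
pose s (k : nat) : R := k.+1%:R^-1.
have s0 k : 0 <= s k by rewrite invr_ge0.
have cvg_s : s k @[k --> \oo] --> (0 : R) by exact: cvg_harmonic.
have mt k := measurable_smooth (smooth_truncation sf k).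
have t2 k := bounded_L2 mu (mt k) (norm_truncation f k).
have vt k : (sqr_variance mu (truncation f k) <=
    (C / 2)%:E * \int[mu]_x (sqr_grad (truncation f k) x)%:E)%E.
  have [M dM] := partial_truncation_bounded sf k.
  apply: (poincare_bounded a0 lsi (smooth_truncation sf k) (M :=
    Num.max k.+1%:R M)).
    by move=> x; rewrite le_max norm_truncation.
  by move=> i x; rewrite le_max dM orbT.
have fatou (L : R) (L_ : nat -> R) : L_ k @[k --> \oo] --> L ->
    (forall k, (C / 2)%:E * \int[mu]_x (sqr_grad (truncation f k) x)%:E <= (L_
      k)%:E)%E ->
    (sqr_variance mu f <= L%:E)%E.
  move=> LL L_le; apply: (variance_fatou mf mt t2 (@truncation_cvg _ _ f) LL)
    => k.
  exact: le_trans (vt k) (L_le k).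
move: C0; rewrite le_eqVlt => /predU1P[C0|C0].
  rewrite -C0 mul0r mul0e; apply: (fatou 0 (fun=> 0)); first exact: cvg_cst.
  by move=> k; rewrite -C0 mul0r mul0e.
have C20 : 0 < C / 2 by rewrite divr_gt0.
have [Eoo|Efin] := eqVneq (\int[mu]_x (sqr_grad f x)%:E)%E +oo%E.
  by rewrite Eoo gt0_muley ?lte_fin// leey.
have Efin' : (\int[mu]_x (sqr_grad f x)%:E)%E \is a fin_num.
  by rewrite ge0_fin_numE ?ltey//; exact: integral_ge0.
rewrite -(fineK Efin'); set e := fine _; rewrite -EFinM.
have [B B0 gB] := sqr_grad_truncation_le sf.
apply: (fatou _ (fun k => C / 2 * ((1 + s k) * e + s k * B))).
  have : C / 2 * ((1 + s k) * e + s k * B) @[k --> \oo] --> C / 2 * ((1 + 0) *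
    e + 0 * B).
    apply: cvgM; first exact: cvg_cst.
    apply: cvgD; (apply: cvgM; last exact: cvg_cst) => //.
    by apply: cvgD => //; exact: cvg_cst.
  by rewrite addr0 mul1r mul0r addr0.
move=> k; rewrite [leRHS]EFinM lee_pmul2l//.
apply: (@le_trans _ _ (\int[mu]_x ((1 + s k)%:E * (sqr_grad f x)%:E + (s k *
  B)%:E))%E).
  apply: ge0_le_integral => //.
  - by move=> x _; rewrite lee_fin sqr_grad_ge0.
  - by apply/measurable_EFinP;
    exact: measurable_sqr_grad (smooth_truncation sf k).
  - by apply: emeasurable_funD => //; exact: emeasurable_funM.
  - by move=> x _; rewrite -EFinM -EFinD lee_fin; exact: gB.
rewrite ge0_integralD//; last 3 first.
- by move=> x _; rewrite mule_ge0// lee_fin addr_ge0.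
- exact: emeasurable_funM.
- by move=> x _; rewrite lee_fin mulr_ge0.
rewrite ge0_integralZl// ?lee_fin ?addr_ge0// integral_cst1 -(fineK Efin') -/e.
by rewrite -EFinM -EFinD.
Qed.

End poincare.

Unset Implicit Arguments.

Theorem proposition2p3 (R : realType) (alpha a : R)
    (halpha : 1 <= alpha <= 2) (ha : 0 < a) :
  (forall (n1 n2 : nat) (mu1 : probability (Rn R n1) R)
      (mu2 : probability (Rn R n2) R) (C1 C2 : R),
    LSI a alpha mu1 C1 -> LSI a alpha mu2 C2 ->
    LSI a alpha (prod_prob mu1 mu2) (Num.max C1 C2))
  /\
  (forall (n : nat) (mu : probability (Rn R n) R) (C : R)
      (h : Rn R n -> R) (mh : measurable_fun setT h) (bh : bounded_fun h),
    LSI a alpha mu C ->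
    LSI a alpha (tilt mu mh bh) (C * expR (osc h)))
  /\
  (forall (n : nat) (mu : probability (Rn R n) R) (C : R),
    LSI a alpha mu C ->
    forall f : 'rV[R]_n -> R, smooth f ->
      (Var mu f <= (C / 2)%:E *
        \int[mu]_x (\sum_(i < n) partial i f x ^+ 2)%:E)%E).
Proof.
split=> [n1 n2 mu1 mu2 C1 C2|]; first exact: LSI_product.
split=> [n mu C h mh bh|n mu C lsi f sf]; first exact: LSI_tilt.
exact: (LSI_poincare ha lsi sf).
Qed.
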